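(* Let $(A,\nwarrow,\nearrow,\swarrow,\searrow)$ be a quadri-algebra with four comultiplications $\alpha,\beta,\tilde\alpha,\tilde\beta:A\to A\otimes A$ such that $(A,\alpha,\beta,\tilde\alpha,\tilde\beta)$ is a quadri-coalgebra, and put $\nwarrow_*:=\alpha^*$, $\nearrow_*:=\beta^*$, $\swarrow_*:=\tilde\alpha^*$, $\searrow_*:=\tilde\beta^*$ (a quadri-algebra structure on $A^*$). Let $\mathfrak B_S$ be the bilinear form on $A\oplus A^*$ given by $\mathfrak B_S(x+a^*,y+b^* )=\langle a^*,y\rangle+\langle x,b^*\rangle$. Then the following conditions are equivalent. (1) $(A_v\bowtie(A^* )_v,A_v,(A^* )_v,\mathfrak B_S)$ is a standard Manin triple of dendriform algebras associated to the nondegenerate 2-cocycle $\mathfrak B_S$. (2) $(A\bowtie A^*,A,A^*,\mathfrak B_S)$ is a standard Manin triple of quadri-algebras associated to the nondegenerate invariant bilinear form $\mathfrak B_S$. (3) $(A_v,(A^* )_v,-R_{\swarrow}^*,L_{\succ}^*,R_{\prec}^*,-L_{\nearrow}^*,-R_{\swarrow_*}^*,L_{\succ_*}^*,R_{\prec_*}^*,-L_{\nearrow_*}^* )$ is a matched pair of dendriform algebras. (4) $(A,A^*,R_{\searrow}^*,L_{\star}^*,-R_{\vee}^*,-L_{\prec}^*,-R_{\succ}^*,-L_{\wedge}^*,R_{\star}^*,L_{\nwarrow}^*,R_{\searrow_*}^*,L_{\star_*}^*,-R_{\vee_*}^*,-L_{\prec_*}^*,-R_{\succ_*}^*,-L_{\wedge_*}^*,R_{\star_*}^*,L_{\nwarrow_*}^*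 )$ is a matched pair of quadri-algebras. (5) $(A,\nwarrow,\nearrow,\swarrow,\searrow,\alpha,\beta,\tilde\alpha,\tilde\beta)$ is a quadri-bialgebra.
   Context: All vector spaces are finite-dimensional over a fixed field $\mathbb F$. A dendriform algebra $(D,\wedge,\vee)$ is a vector space with two bilinear operations such that, with $x\star y=x\wedge y+x\vee y$: $(x\wedge y)\wedge z=x\wedge(y\star z)$, $(x\vee y)\wedge z=x\vee(y\wedge z)$, $(x\star y)\vee z=x\vee(y\vee z)$. A quadri-algebra $(A,\nwarrow,\nearrow,\swarrow,\searrow)$ is a vector space with four bilinear operations; put $x\succ y=x\nearrow y+x\searrow y$, $x\prec y=x\nwarrow y+x\swarrow y$, $x\vee y=x\swarrow y+x\searrow y$, $x\wedge y=x\nwarrow y+x\nearrow y$, $x\star y=x\nwarrow y+x\nearrow y+x\swarrow y+x\searrow y$; the axioms are, for all $x,y,z$: $(x\nwarrow y)\nwarrow z=x\nwarrow(y\star z)$, $(x\nearrow y)\nwarrow z=x\nearrow(y\prec z)$, $(x\wedge y)\nearrow z=x\nearrow(y\succ z)$, $(x\swarrow y)\nwarrow z=x\swarrow(y\wedge z)$, $(x\searrow y)\nwarrow z=x\searrow(y\nwarrow z)$, $(x\vee y)\nearrow z=x\searrow(y\nearrow z)$, $(x\prec y)\swarrow z=x\swarrow(y\vee z)$, $(x\succ y)\swarrow z=x\searrow(y\swarrow z)$, $(x\star y)\searrow z=x\searrow(y\searrow z)$. Then $A_v:=(A,\wedge,\vee)$ is a dendriform algebra (the associated vertical dendriform algebra).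 For a quadri-algebra structure on $A^*$ the operations carry a subscript $*$ (also $\succ_*,\prec_*,\vee_*,\wedge_*,\star_*$), and $(A^* )_v=(A^*,\wedge_*,\vee_* )$. $L_\circ(x)y=x\circ y=R_\circ(y)x$. For a linear map $\rho:A\to\mathfrak{gl}(V)$, $\rho^*:A\to\mathfrak{gl}(V^* )$ is $\langle\rho^*(x)v^*,u\rangle=\langle v^*,\rho(x)u\rangle$ (no sign); $A^{**}=A$. A 2-cocycle on a dendriform algebra $(D,\wedge,\vee)$ is a symmetric bilinear form with $\mathfrak B(x\star y,z)=\mathfrak B(y,z\wedge x)+\mathfrak B(x,y\vee z)$. A symmetric bilinear form on a quadri-algebra is invariant if $\mathfrak B(x\nwarrow y,z)=\mathfrak B(x,y\star z)$, $\mathfrak B(x\nearrow y,z)=-\mathfrak B(y,z\vee x)$, $\mathfrak B(x\swarrow y,z)=-\mathfrak B(x,y\wedge z)$, $\mathfrak B(x\searrow y,z)=\mathfrak B(y,z\star x)$ for all $x,y,z$. Standard Manin triple of dendriform algebras: given dendriform algebra structures on $A$ and on $A^*$ (here those of $A_v$ and $(A^* )_v$), if there is a dendriform algebra structure on $A\oplus A^*$ such that $A$ and $A^*$ are dendriform subalgebras and $\mathfrak B_S$ is a 2-cocycle, then $A\oplus A^*$ with this structure (here written $A_v\bowtie(A^* )_v$), together with $A$, $A^*$ and $\mathfrak B_S$, is called a standard Manin triple of dendriform algebras associated to $\mathfrak B_S$. Standard Manin triple of quadri-algebras: given quadri-algebra structures on $A$ and on $A^*$, if there is a quadri-algebra structure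 on $A\oplus A^*$ (written $A\bowtie A^*$) such that $A$ and $A^*$ are quadri-subalgebras and $\mathfrak B_S$ is invariant, then $(A\bowtie A^*,A,A^*,\mathfrak B_S)$ is called a standard Manin triple of quadri-algebras associated to the nondegenerate invariant bilinear form $\mathfrak B_S$. Matched pair of dendriform algebras $(A,B,l_{\wedge_A},r_{\wedge_A},l_{\vee_A},r_{\vee_A},l_{\wedge_B},r_{\wedge_B},l_{\vee_B},r_{\vee_B})$: dendriform algebras $A,B$ and linear maps $l_{\diamond_A},r_{\diamond_A}:A\to\mathfrak{gl}(B)$, $l_{\diamond_B},r_{\diamond_B}:B\to\mathfrak{gl}(A)$ ($\diamond\in\{\wedge,\vee\}$) such that $(x+a)\diamond(y+b)=x\diamond_Ay+l_{\diamond_B}(a)y+r_{\diamond_B}(b)x+a\diamond_Bb+l_{\diamond_A}(x)b+r_{\diamond_A}(y)a$ defines a dendriform algebra on $A\oplus B$. Matched pair of quadri-algebras: the same with $\diamond\in\{\nwarrow,\nearrow,\swarrow,\searrow\}$ and ''quadri-algebra'' in place of ''dendriform algebra'', the data being listed as $(A,B,l_{\nwarrow_A},r_{\nwarrow_A},l_{\nearrow_A},r_{\nearrow_A},l_{\swarrow_A},r_{\swarrow_A},l_{\searrow_A},r_{\searrow_A}$, then the same for $B)$. $(A,\alpha,\beta,\tilde\alpha,\tilde\beta)$ with linear maps $A\to A\otimes A$ is a quadri-coalgebra if $(A^*,\alpha^*,\beta^*,\tilde\alpha^*,\tilde\beta^* )$ is a quadri-algebra (in the order $\nwarrow_*,\nearrow_*,\swarrow_*,\searrow_*$),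 where $\langle\alpha^*(a^*\otimes b^* ),x\rangle=\langle a^*\otimes b^*,\alpha(x)\rangle$, etc. A quadri-bialgebra is a quadri-algebra that is also a quadri-coalgebra such that for all $x,y\in A$ ($\tau$ the flip of $A\otimes A$): $\tilde\alpha(x\star y)=(R_\wedge(y)\otimes1)\tilde\alpha(x)+(1\otimes L_\succ(x))\tilde\alpha(y)$; $\beta(x\star y)=(R_\prec(y)\otimes1)\beta(x)+(1\otimes L_\vee(x))\beta(y)$; $(\beta+\tilde\beta)(x\wedge y)=(R_\nwarrow(y)\otimes1)(\beta+\tilde\beta)(x)+(1\otimes L_\wedge(x))\tilde\beta(y)$; $(\alpha+\tilde\alpha)(x\wedge y)=(R_\wedge(y)\otimes1)(\alpha+\tilde\alpha)(x)+(1\otimes L_\nearrow(x))\tilde\alpha(y)$; $(\beta+\tilde\beta)(x\vee y)=(1\otimes L_\vee(x))(\beta+\tilde\beta)(y)+(R_\swarrow(y)\otimes1)\beta(x)$; $(\alpha+\tilde\alpha)(x\vee y)=(1\otimes L_\searrow(x))(\alpha+\tilde\alpha)(y)+(R_\vee(y)\otimes1)\alpha(x)$; $(\alpha+\beta)(x\succ y)=(1\otimes L_\searrow(x))(\alpha+\beta)(y)+(R_\succ(y)\otimes1)\alpha(x)$; $(\tilde\alpha+\tilde\beta)(x\succ y)=(1\otimes L_\succ(x))(\tilde\alpha+\tilde\beta)(y)+(R_\nearrow(y)\otimes1)\tilde\alpha(x)$; $(\alpha+\beta)(x\prec y)=(R_\prec(y)\otimes1)(\alpha+\beta)(x)+(1\otimes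 L_\swarrow(x))\beta(y)$; $(\tilde\alpha+\tilde\beta)(x\prec y)=(R_\nwarrow(y)\otimes1)(\tilde\alpha+\tilde\beta)(x)+(1\otimes L_\prec(x))\tilde\beta(y)$; $(1\otimes L_\succ(y)-R_\wedge(y)\otimes1)\tau\beta(x)=(1\otimes R_\prec(x)-L_\vee(x)\otimes1)\tilde\alpha(y)$; $(1\otimes R_\nwarrow(x)-L_\vee(x)\otimes1)(\alpha+\tilde\alpha)(y)=(1\otimes L_\nearrow(y))\tau\beta(x)-(R_\vee(y)\otimes1)\tau\tilde\beta(x)$; $(R_\wedge(y)\otimes1-1\otimes L_\searrow(y))(\tau\beta+\tau\tilde\beta)(x)=(L_\wedge(x)\otimes1)\alpha(y)-(1\otimes R_\swarrow(x))\tilde\alpha(y)$; $(1\otimes L_\succ(x)-R_\nwarrow(x)\otimes1)(\tau\alpha+\tau\beta)(y)=(1\otimes R_\succ(y))\tilde\beta(x)-(L_\swarrow(y)\otimes1)\tilde\alpha(x)$; $(1\otimes L_\searrow(x)-R_\prec(x)\otimes1)(\tau\tilde\alpha+\tau\tilde\beta)(y)=(1\otimes R_\nearrow(y))\beta(x)-(L_\prec(y)\otimes1)\alpha(x)$; $(\alpha+\tilde\alpha+\beta+\tilde\beta)(x\swarrow y)=(R_\swarrow(y)\otimes1)(\alpha+\beta)(x)+(1\otimes L_\swarrow(x))(\beta+\tilde\beta)(y)$; $(\alpha+\beta+\tilde\alpha+\tilde\beta)(x\nearrow y)=(R_\nearrow(y)\otimes1)(\alpha+\tilde\alpha)(x)+(1\otimes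 L_\nearrow(x))(\tilde\alpha+\tilde\beta)(y)$; $(L_\swarrow(y)\otimes1)(\alpha+\tilde\alpha)(x)+(1\otimes L_\nearrow(x))(\tau\alpha+\tau\beta)(y)=(R_\swarrow(x)\otimes1)(\tau\tilde\alpha+\tau\tilde\beta)(y)+(1\otimes R_\nearrow(y))(\beta+\tilde\beta)(x)$.
   Formalization: Condition (1) additionally requires that the quadri-algebra operations induced on the dendriform algebra by the 2-cocycle B_S restrict to the given ones on A and A*; without this, (1) does not imply (5), e.g. when A_v and (A* )_v are both zero. *)

(* Defs.v *)
From HB Require Import structures.
From mathcomp Require Import all_boot all_order all_algebra.

Set Implicit Arguments.
Unset Strict Implicit.
Unset Printing Implicit Defensive.

Import GRing.Theory.
Local Open Scope ring_scope.

(** * Linear algebra *)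

Definition dual (F : fieldType) (V : vectType F) : predArgType := 'Hom(V, F^o).
HB.instance Definition _ F V := Vector.on (@dual F V).
Identity Coercion hom_of_dual : dual >-> hom.

(* Linear maps A -> gl(V).  [bilop A] is the type of bilinear operations on A,
   curried. *)
Notation act A V := 'Hom(A, 'End(V)).
Notation bilop A := 'Hom(A, 'End(A)).

(* A (+) A^* *)
Notation dsum A := (A * dual A)%type.

(* As the spaces are finite-dimensional, U (x) V is taken to be the space of
   bilinear forms on U^* x V^*: x (x) y is the form (p, q) |-> p x * q y, and the
   pairing <p (x) q, T> is T p q.  See [pure] and [tensor_decomp] below. *)
Definition tensor (F : fieldType) (U V : vectType F) : predArgType :=
  'Hom(dual U, 'Hom(dual V, F^o)).
HB.instance Definition _ F U V := Vector.on (@tensor F U V).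
Identity Coercion hom_of_tensor : tensor >-> hom.

Section LinearAlgebra.
Context {F : fieldType}.
Implicit Types A U V W : vectType F.

Lemma linfun_linE U V (f : U -> V) : linear f -> linfun f =1 f.
Proof.
move=> lf x.
pose L := GRing.isLinear.Build _ _ _ _ f lf.
pose ff : {linear U -> V} := HB.pack f L.
exact: (lfunE ff).
Qed.

(* Meaningful only when f is bilinear, see mkbilE; every use below is followed
   by a lemma computing its values. *)
Definition mkbil U V W (f : U -> V -> W) : 'Hom(U, 'Hom(V, W)) :=
  linfun (fun x => linfun (f x)).

Lemma mkbilE U V W (f : U -> V -> W) :
    (forall x, linear (f x)) -> (forall y, linear (f^~ y)) ->
  forall x y, mkbil f x y = f x y.
Proof.
move=> lr ll x y.
rewrite /mkbil linfun_linE ?linfun_linE // => k u v.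
apply/lfunP => z; rewrite add_lfunE scale_lfunE !linfun_linE //; exact: ll.
Qed.

Lemma dualP V (p q : dual V) : p =1 q -> p = q.
Proof. by move=> h; apply/lfunP. Qed.

Lemma dualD V (p q : dual V) x : (p + q) x = p x + q x.
Proof. exact: add_lfunE. Qed.

Lemma dualN V (p : dual V) x : (- p) x = - p x.
Proof. exact: opp_lfunE. Qed.

Lemma dualZ V k (p : dual V) x : (k *: p) x = k * p x.
Proof. exact: scale_lfunE. Qed.

Lemma dual0 V x : (0 : dual V) x = 0.
Proof. exact: zero_lfunE. Qed.

Definition coordf V (i : 'I_(\dim {:V})) : dual V :=
  linfun (coord (vbasis {:V}) i : V -> F^o).

Lemma coordfE V (i : 'I_(\dim {:V})) (x : V) :
  coordf i x = coord (vbasis {:V}) i x.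
Proof. by rewrite /coordf linfun_linE // => k u v; rewrite linearP. Qed.

Lemma dual_sep V (x y : V) : (forall p : dual V, p x = p y) -> x = y.
Proof.
move=> eq_xy; rewrite (coord_vbasis (memvf x)) (coord_vbasis (memvf y)).
by apply: eq_bigr => i _; rewrite -!coordfE eq_xy.
Qed.

(* The canonical isomorphism V -> V^**. *)
Definition evdual V : 'Hom(V, dual (dual V)) :=
  mkbil (fun x (p : dual V) => p x : F^o).

Lemma evdualE V (x : V) (p : dual V) : evdual V x p = p x.
Proof.
rewrite /evdual mkbilE // => [y k u v|q k u v]; last by rewrite linearP.
by rewrite dualD dualZ.
Qed.

Lemma evdual_lker0 V : lker (evdual V) == 0%VS.
Proof.
apply/lker0P => x y exy; apply: dual_sep => p.
by rewrite -(evdualE x p) exy evdualE.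
Qed.

Lemma evdualK V : cancel (evdual V) (evdual V)^-1%VF.
Proof. exact/lker0_lfunK/evdual_lker0. Qed.

Lemma dim_dual V : dim (dual V) = dim V.
Proof. exact: muln1. Qed.

Lemma evdualVK V : cancel (evdual V)^-1%VF (evdual V).
Proof.
move=> g; apply: limg_lfunVK.
suff -> : limg (evdual V) = fullv by rewrite memvf.
apply/eqP; rewrite eqEdim subvf /= limg_dim_eq.
  by rewrite !dimvf !dim_dual.
by apply/eqP; rewrite capfv evdual_lker0.
Qed.

(* rho^*, without sign: <rho^*(x) p, u> = <p, rho(x) u>. *)
Definition dualrep A V (rho : act A V) : act A (dual V) :=
  mkbil (fun x (p : dual V) => (p \o rho x)%VF : dual V).

Lemma dualrepE A V (rho : act A V) x (p : dual V) u :
  dualrep rho x p u = p (rho x u).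
Proof.
rewrite /dualrep mkbilE ?comp_lfunE // => [{}x|{}p] k v w; apply: dualP => z.
  by rewrite dualD dualZ !comp_lfunE dualD dualZ.
by rewrite dualD dualZ !comp_lfunE linearP add_lfunE scale_lfunE linearP.
Qed.

(* rho^* for rho : A -> gl (V^* ), as a map A -> gl(V) under V^** = V. *)
Definition predualrep A V (rho : act A (dual V)) : act A V :=
  mkbil (fun a x => (evdual V)^-1%VF ((evdual V x \o rho a)%VF : dual (dual V))).

Lemma predualrepE A V (rho : act A (dual V)) a x (p : dual V) :
  p (predualrep rho a x) = rho a p x.
Proof.
rewrite /predualrep mkbilE => [|{}a k v w|{}x k v w].
- by rewrite -(evdualE (_ ^-1%VF _)) evdualVK comp_lfunE evdualE.
- rewrite -linearP; congr (_ _); apply: dualP => z.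
  by rewrite dualD dualZ !comp_lfunE !evdualE linearP.
- rewrite -linearP; congr (_ _); apply: dualP => z.
  rewrite dualD dualZ !comp_lfunE !evdualE linearP add_lfunE scale_lfunE.
  by rewrite dualD dualZ.
Qed.

Definition Lop A (op : bilop A) : act A A := op.
Definition Rop A (op : bilop A) : act A A := mkbil (fun y x => op x y).

Lemma RopE A (op : bilop A) y x : Rop op y x = op x y.
Proof.
rewrite /Rop mkbilE // => [{}y|{}x] k u v; last by rewrite linearP.
by rewrite linearP add_lfunE scale_lfunE.
Qed.

(** ** Tensors *)

Lemma tensorP U V (S T : tensor U V) : (forall p q, S p q = T p q) -> S = T.
Proof. by move=> h; apply/lfunP => p; apply/lfunP => q. Qed.

Lemma tensorD U V (S T : tensor U V) p q : (S + T) p q = S p q + T p q.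
Proof. by rewrite !add_lfunE. Qed.

Lemma tensorN U V (T : tensor U V) p q : (- T) p q = - T p q.
Proof. by rewrite !opp_lfunE. Qed.

Lemma tensorZ U V k (T : tensor U V) p q : (k *: T) p q = k * T p q.
Proof. by rewrite !scale_lfunE. Qed.

Lemma tensor_linl U V (T : tensor U V) q : linear (T^~ q : dual U -> F^o).
Proof. by move=> k u v; rewrite linearP add_lfunE scale_lfunE. Qed.

Lemma tensor_linr U V (T : tensor U V) p : linear (T p : dual V -> F^o).
Proof. by move=> k u v; rewrite linearP. Qed.

Definition pure U V (x : U) (y : V) : tensor U V :=
  mkbil (fun (p : dual U) (q : dual V) => p x * q y : F^o).

Lemma pureE U V (x : U) (y : V) (p : dual U) (q : dual V) :
  pure x y p q = p x * q y.
Proof.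
rewrite /pure mkbilE // => [{}p|{}q] k u v; rewrite dualD dualZ /GRing.scale /=.
  by rewrite mulrDr mulrCA.
by rewrite mulrDl mulrA.
Qed.

(* f (x) g *)
Definition tmap U V U' V' (f : 'Hom(U, U')) (g : 'Hom(V, V')) (T : tensor U V) :
    tensor U' V' :=
  mkbil (fun (p : dual U') (q : dual V') =>
    T ((p \o f)%VF : dual U) ((q \o g)%VF : dual V)).

Lemma tmapE U V U' V' (f : 'Hom(U, U')) (g : 'Hom(V, V')) (T : tensor U V)
    (p : dual U') (q : dual V') :
  tmap f g T p q = T ((p \o f)%VF : dual U) ((q \o g)%VF : dual V).
Proof.
rewrite /tmap mkbilE // => [{}p|{}q] k u v.
  rewrite -tensor_linr; congr (T _ _); apply: dualP => x.
  by rewrite dualD dualZ !comp_lfunE dualD dualZ.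
rewrite -tensor_linl; congr (T _ _); apply: dualP => x.
by rewrite dualD dualZ !comp_lfunE dualD dualZ.
Qed.

Lemma tmap_linear U V U' V' (f : 'Hom(U, U')) (g : 'Hom(V, V')) :
  linear (@tmap U V U' V' f g).
Proof.
by move=> k S T; apply: tensorP => p q; rewrite tensorD tensorZ !tmapE tensorD tensorZ.
Qed.

Lemma tmap_pure U V U' V' (f : 'Hom(U, U')) (g : 'Hom(V, V')) x y :
  tmap f g (pure x y) = pure (f x) (g y).
Proof. by apply: tensorP => p q; rewrite tmapE !pureE !comp_lfunE. Qed.

(* the flip tau *)
Definition flip U V (T : tensor U V) : tensor V U :=
  mkbil (fun (p : dual V) (q : dual U) => T q p).

Lemma flipE U V (T : tensor U V) (p : dual V) (q : dual U) : flip T p q = T q p.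
Proof.
by rewrite /flip mkbilE // => [{}p|{}q] k u v; rewrite (tensor_linl, tensor_linr).
Qed.

Lemma flip_linear U V : linear (@flip U V).
Proof.
by move=> k S T; apply: tensorP => p q; rewrite tensorD tensorZ !flipE tensorD tensorZ.
Qed.

Lemma flip_pure U V (x : U) (y : V) : flip (pure x y) = pure y x.
Proof. by apply: tensorP => p q; rewrite flipE !pureE mulrC. Qed.

Lemma dual_decomp V (p : dual V) :
  p = \sum_(i < \dim {:V}) p (vbasis {:V})`_i *: coordf i.
Proof.
apply: dualP => x; rewrite sum_lfunE.
rewrite {1}(coord_vbasis (memvf x)) linear_sum /=; apply: eq_bigr => i _.
by rewrite linearZ dualZ coordfE; apply: mulrC.
Qed.

Lemma tensor_decomp U V (T : tensor U V) :
  T = \sum_(i < \dim {:U}) \sum_(j < \dim {:V})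
    T (coordf i) (coordf j) *: pure (vbasis {:U})`_i (vbasis {:V})`_j.
Proof.
apply: tensorP => p q; rewrite !sum_lfunE.
rewrite {1}(dual_decomp p) linear_sum sum_lfunE; apply: eq_bigr => i _.
rewrite linearZ scale_lfunE !sum_lfunE.
rewrite {1}(dual_decomp q) linear_sum scaler_sumr; apply: eq_bigr => j _.
by rewrite tensorZ pureE linearZ /GRing.scale /= mulrA mulrC.
Qed.

(* The transpose D^* : V^* (x) V^* -> V^* of a comultiplication D, as a bilinear
   operation on V^*: <D^*(p (x) q), x> = <p (x) q, D x>. *)
Definition codual V (D : 'Hom(V, tensor V V)) : bilop (dual V) :=
  mkbil (fun p q : dual V => linfun (fun x => D x p q) : dual V).

Lemma codualE V (D : 'Hom(V, tensor V V)) (p q : dual V) x :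
  codual D p q x = D x p q.
Proof.
have lD p' q' : linear (fun x => D x p' q' : F^o).
  by move=> k u v; rewrite linearP tensorD tensorZ.
rewrite /codual mkbilE ?linfun_linE // => [{}p|{}q] k u v; apply: dualP => z.
  by rewrite dualD dualZ !linfun_linE // tensor_linr.
by rewrite dualD dualZ !linfun_linE // tensor_linl.
Qed.

End LinearAlgebra.

(** * Dendriform algebras and quadri-algebras *)

Section Algebras.
Context {F : fieldType}.
Implicit Types A B V W : vectType F.

Record dendriOps A := DendriOps { dwedge : bilop A; dvee : bilop A }.

Definition dstar A (D : dendriOps A) : bilop A := dwedge D + dvee D.

Definition is_dendriform A (D : dendriOps A) : Prop :=
  let wedge := dwedge D in let vee := dvee D in let star := dstar D in
  forall x y z : A,
    [/\ wedge (wedge x y) z = wedge x (star y z),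
        wedge (vee x y) z = vee x (wedge y z)
      & vee (star x y) z = vee x (vee y z)].

(* nw, ne, sw, se stand for the arrows \nwarrow, \nearrow, \swarrow, \searrow. *)
Record quadriOps A := QuadriOps {
  qnw : bilop A; qne : bilop A; qsw : bilop A; qse : bilop A }.

Definition qsucc A (Q : quadriOps A) : bilop A := qne Q + qse Q.
Definition qprec A (Q : quadriOps A) : bilop A := qnw Q + qsw Q.
Definition qvee A (Q : quadriOps A) : bilop A := qsw Q + qse Q.
Definition qwedge A (Q : quadriOps A) : bilop A := qnw Q + qne Q.
Definition qstar A (Q : quadriOps A) : bilop A := qnw Q + qne Q + qsw Q + qse Q.

Definition is_quadri A (Q : quadriOps A) : Prop :=
  let nw := qnw Q in let ne := qne Q in let sw := qsw Q in let se := qse Q in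
  let succ := qsucc Q in let prec := qprec Q in
  let vee := qvee Q in let wedge := qwedge Q in let star := qstar Q in
  forall x y z : A,
    [/\ [/\ nw (nw x y) z = nw x (star y z),
            nw (ne x y) z = ne x (prec y z)
          & ne (wedge x y) z = ne x (succ y z)],
        [/\ nw (sw x y) z = sw x (wedge y z),
            nw (se x y) z = se x (nw y z)
          & ne (vee x y) z = se x (ne y z)]
      & [/\ sw (prec x y) z = sw x (vee y z),
            sw (succ x y) z = se x (sw y z)
          & se (star x y) z = se x (se y z)]].

(* The associated vertical dendriform algebra A_v. *)
Definition vert A (Q : quadriOps A) : dendriOps A :=
  DendriOps (qwedge Q) (qvee Q).

(** ** Bilinear forms *)

Definition symmetric_form V (B : 'Hom(V, dual V)) : Prop :=
  forall u v, B u v = B v u.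

Definition nondegenerate V (B : 'Hom(V, dual V)) : Prop :=
  forall u, (forall v, B u v = 0) -> u = 0.

Definition two_cocycle V (D : dendriOps V) (B : 'Hom(V, dual V)) : Prop :=
  symmetric_form B /\
  forall x y z, B (dstar D x y) z = B y (dwedge D z x) + B x (dvee D y z).

Definition invariant_form V (Q : quadriOps V) (B : 'Hom(V, dual V)) : Prop :=
  symmetric_form B /\
  forall x y z,
    [/\ B (qnw Q x y) z = B x (qstar Q y z),
        B (qne Q x y) z = - B y (qvee Q z x),
        B (qsw Q x y) z = - B x (qwedge Q y z)
      & B (qse Q x y) z = B y (qstar Q z x)].

(* The standard form B_S on A (+) A^*. *)
Definition BS A : 'Hom(dsum A, dual (dsum A)) :=
  mkbil (fun u v : dsum A => u.2 v.1 + v.2 u.1 : F^o).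

Lemma BSE A (x y : A) (a b : dual A) : BS A (x, a) (y, b) = a y + b x.
Proof.
rewrite /BS mkbilE //= => [u|u] k v w /=.
  by rewrite linearP dualD dualZ scalerDr addrACA.
by rewrite linearP dualD dualZ scalerDr addrACA.
Qed.

Lemma BS_sym A : symmetric_form (BS A).
Proof. by move=> [x a] [y b]; rewrite !BSE addrC. Qed.

Lemma BS_nondegenerate A : nondegenerate (BS A).
Proof.
move=> [x a] h; congr (_, _).
  apply: dual_sep => p; have := h (0, p).
  by rewrite BSE !linear0 add0r.
apply: dualP => y; have := h (y, 0).
by rewrite BSE !dual0 addr0.
Qed.

(** ** Manin triples *)

Definition dendri_hom A V (DA : dendriOps A) (D : dendriOps V) (i : A -> V) :
    Prop :=
  forall x y, i (dwedge DA x y) = dwedge D (i x) (i y) /\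
              i (dvee DA x y) = dvee D (i x) (i y).

Definition quadri_hom A V (QA : quadriOps A) (Q : quadriOps V) (i : A -> V) :
    Prop :=
  forall x y, [/\ i (qnw QA x y) = qnw Q (i x) (i y),
                  i (qne QA x y) = qne Q (i x) (i y),
                  i (qsw QA x y) = qsw Q (i x) (i y)
                & i (qse QA x y) = qse Q (i x) (i y)].

Definition inA A (x : A) : dsum A := (x, 0).
Definition inD A (a : dual A) : dsum A := (0, a).

(* D makes A (+) A^* a standard Manin triple of dendriform algebras extending
   DA and DAs. *)
Definition dendri_manin_triple A (DA : dendriOps A) (DAs : dendriOps (dual A))
    (D : dendriOps (dsum A)) : Prop :=
  [/\ is_dendriform D, dendri_hom DA D (@inA A), dendri_hom DAs D (@inD A)
    & two_cocycle D (BS A)].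

Definition quadri_manin_triple A (QA : quadriOps A) (QAs : quadriOps (dual A))
    (Q : quadriOps (dsum A)) : Prop :=
  [/\ is_quadri Q, quadri_hom QA Q (@inA A), quadri_hom QAs Q (@inD A)
    & invariant_form Q (BS A)].

(* A nondegenerate 2-cocycle B on a dendriform algebra D determines a
   quadri-algebra structure on D with D as its vertical dendriform algebra, by
     B (x nw y) w = B x (y star w),    B (x ne y) w = - B y (w vee x),
     B (x sw y) w = - B x (y wedge w), B (x se y) w = B y (w star x),
   that is, by invariance of B.  [splits_by B D QA i] says that on the subalgebra
   i(A) these operations are those of QA.  A dendriform Manin triple involves the
   quadri-algebras A and A^* only through A_v and (A^* )_v, so this does not follow
   from [dendri_manin_triple]: if the products of A_v and (A^* )_v vanish, then the
   zero products on A (+) A^* are always a dendriform Manin triple. *)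
Definition splits_by A V (B : 'Hom(V, dual V)) (D : dendriOps V)
    (QA : quadriOps A) (i : A -> V) : Prop :=
  forall x y w,
    [/\ B (i (qnw QA x y)) w = B (i x) (dstar D (i y) w),
        B (i (qne QA x y)) w = - B (i y) (dvee D w (i x)),
        B (i (qsw QA x y)) w = - B (i x) (dwedge D (i y) w)
      & B (i (qse QA x y)) w = B (i y) (dstar D w (i x))].

(** ** Matched pairs *)

(* (x+a) o (y+b) = x o y + lB(a) y + rB(b) x + a o b + lA(x) b + rA(y) a *)
Definition bowtie_op A B (oA : bilop A) (oB : bilop B)
    (lA rA : act A B) (lB rB : act B A) : bilop (A * B)%type :=
  mkbil (fun u v : A * B =>
    (oA u.1 v.1 + lB u.2 v.1 + rB v.2 u.1,
     oB u.2 v.2 + lA u.1 v.2 + rA v.1 u.2)).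

Lemma bowtie_opE A B (oA : bilop A) (oB : bilop B)
    (lA rA : act A B) (lB rB : act B A) x a y b :
  bowtie_op oA oB lA rA lB rB (x, a) (y, b) =
    (oA x y + lB a y + rB b x, oB a b + lA x b + rA y a).
Proof.
have aux (W : vectType F) (k : F) (p q r p' q' r' : W) :
    (k *: p + p') + (k *: q + q') + (k *: r + r') =
    k *: (p + q + r) + (p' + q' + r').
  by rewrite (addrACA (k *: p)) (addrACA (k *: p + _)) !scalerDr.
rewrite /bowtie_op mkbilE //= => u k v w; congr (_, _) => /=;
  by rewrite !linearP ?add_lfunE ?scale_lfunE aux.
Qed.

Record dendriActs A V := DendriActs {
  lwedge : act A V; rwedge : act A V; lvee : act A V; rvee : act A V }.

Definition dendri_bowtie A B (DA : dendriOps A) (DB : dendriOps B)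
    (p : dendriActs A B) (q : dendriActs B A) : dendriOps (A * B)%type :=
  DendriOps
    (bowtie_op (dwedge DA) (dwedge DB) (lwedge p) (rwedge p) (lwedge q) (rwedge q))
    (bowtie_op (dvee DA) (dvee DB) (lvee p) (rvee p) (lvee q) (rvee q)).

Definition dendri_matched_pair A B (DA : dendriOps A) (DB : dendriOps B)
    (p : dendriActs A B) (q : dendriActs B A) : Prop :=
  [/\ is_dendriform DA, is_dendriform DB & is_dendriform (dendri_bowtie DA DB p q)].

Record quadriActs A V := QuadriActs {
  lnw : act A V; rnw : act A V; lne : act A V; rne : act A V;
  lsw : act A V; rsw : act A V; lse : act A V; rse : act A V }.

Definition quadri_bowtie A B (QA : quadriOps A) (QB : quadriOps B)
    (p : quadriActs A B) (q : quadriActs B A) : quadriOps (A * B)%type :=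
  QuadriOps
    (bowtie_op (qnw QA) (qnw QB) (lnw p) (rnw p) (lnw q) (rnw q))
    (bowtie_op (qne QA) (qne QB) (lne p) (rne p) (lne q) (rne q))
    (bowtie_op (qsw QA) (qsw QB) (lsw p) (rsw p) (lsw q) (rsw q))
    (bowtie_op (qse QA) (qse QB) (lse p) (rse p) (lse q) (rse q)).

Definition quadri_matched_pair A B (QA : quadriOps A) (QB : quadriOps B)
    (p : quadriActs A B) (q : quadriActs B A) : Prop :=
  [/\ is_quadri QA, is_quadri QB & is_quadri (quadri_bowtie QA QB p q)].

(** ** Quadri-bialgebras *)

(* al, be, tal, tbe are the comultiplications dual to nw, ne, sw, se. *)
Definition codual_ops A (al be tal tbe : 'Hom(A, tensor A A)) :
    quadriOps (dual A) :=
  QuadriOps (codual al) (codual be) (codual tal) (codual tbe).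

Definition is_quadri_coalgebra A (al be tal tbe : 'Hom(A, tensor A A)) : Prop :=
  is_quadri (codual_ops al be tal tbe).

Local Notation "f ⊗ g" := (tmap f g) (at level 35, no associativity).

Definition is_quadri_bialgebra A (Q : quadriOps A)
    (al be tal tbe : 'Hom(A, tensor A A)) : Prop :=
  let nw := qnw Q in let ne := qne Q in let sw := qsw Q in let se := qse Q in
  let succ := qsucc Q in let prec := qprec Q in
  let vee := qvee Q in let wedge := qwedge Q in let star := qstar Q in
  let L := @Lop F A in let R := @Rop F A in let id := (\1%VF : 'End(A)) in
  let tau := @flip F A A in
  [/\ is_quadri Q, is_quadri_coalgebra al be tal tbe &
  forall x y : A,
    [/\ [/\ tal (star x y) =
              (R wedge y ⊗ id) (tal x) + (id ⊗ L succ x) (tal y),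
            be (star x y) =
              (R prec y ⊗ id) (be x) + (id ⊗ L vee x) (be y),
            (be + tbe) (wedge x y) =
              (R nw y ⊗ id) ((be + tbe) x) + (id ⊗ L wedge x) (tbe y),
            (al + tal) (wedge x y) =
              (R wedge y ⊗ id) ((al + tal) x) + (id ⊗ L ne x) (tal y)
          & (be + tbe) (vee x y) =
              (id ⊗ L vee x) ((be + tbe) y) + (R sw y ⊗ id) (be x)],
        [/\ (al + tal) (vee x y) =
              (id ⊗ L se x) ((al + tal) y) + (R vee y ⊗ id) (al x),
            (al + be) (succ x y) =
              (id ⊗ L se x) ((al + be) y) + (R succ y ⊗ id) (al x),
            (tal + tbe) (succ x y) =
              (id ⊗ L succ x) ((tal + tbe) y) + (R ne y ⊗ id) (tal x),
            (al + be) (prec x y) =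
              (R prec y ⊗ id) ((al + be) x) + (id ⊗ L sw x) (be y)
          & (tal + tbe) (prec x y) =
              (R nw y ⊗ id) ((tal + tbe) x) + (id ⊗ L prec x) (tbe y)],
        [/\ (id ⊗ L succ y) (tau (be x)) - (R wedge y ⊗ id) (tau (be x)) =
              (id ⊗ R prec x) (tal y) - (L vee x ⊗ id) (tal y),
            (id ⊗ R nw x) ((al + tal) y) - (L vee x ⊗ id) ((al + tal) y) =
              (id ⊗ L ne y) (tau (be x)) - (R vee y ⊗ id) (tau (tbe x)),
            (R wedge y ⊗ id) (tau (be x) + tau (tbe x))
                - (id ⊗ L se y) (tau (be x) + tau (tbe x)) =
              (L wedge x ⊗ id) (al y) - (id ⊗ R sw x) (tal y),
            (id ⊗ L succ x) (tau (al y) + tau (be y))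
                - (R nw x ⊗ id) (tau (al y) + tau (be y)) =
              (id ⊗ R succ y) (tbe x) - (L sw y ⊗ id) (tal x)
          & (id ⊗ L se x) (tau (tal y) + tau (tbe y))
                - (R prec x ⊗ id) (tau (tal y) + tau (tbe y)) =
              (id ⊗ R ne y) (be x) - (L prec y ⊗ id) (al x)]
      & [/\ (al + tal + be + tbe) (sw x y) =
              (R sw y ⊗ id) ((al + be) x) + (id ⊗ L sw x) ((be + tbe) y),
            (al + be + tal + tbe) (ne x y) =
              (R ne y ⊗ id) ((al + tal) x) + (id ⊗ L ne x) ((tal + tbe) y)
          & (L sw y ⊗ id) ((al + tal) x) + (id ⊗ L ne x) (tau (al y) + tau (be y)) =
              (R sw x ⊗ id) (tau (tal y) + tau (tbe y))
              + (id ⊗ R ne y) ((be + tbe) x)]]].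

End Algebras.

(* Main.v *)
Require Import Defs.
From mathcomp Require Import all_boot all_order all_algebra ring.
Import GRing.Theory.
Local Open Scope ring_scope.

(* With respect to an invariant form every product of a quadri-algebra has two
   transposes, B (x o y) z = B x (y o_l z) = B y (z o_r x), where o_l and o_r are
   again, up to sign, among the nine products.  Hence invariant quadri-operations
   are determined on A (+) A^* by their restrictions to A and A^*, and they are
   the bowtie operations of (4), which always form an invariant system whose
   vertical part is the bowtie of (3).  For an invariant system with nondegenerate
   form the quadri-algebra axioms follow from the vertical dendriform ones, and a
   nondegenerate 2-cocycle always comes from such a system; so (1)-(4) all say
   that this one vertical bowtie is dendriform.
   Paired with a fourth vector, the dendriform axioms become identities between
   values of B on products of two factors.  They hold as soon as three of the four
   arguments lie in one of the two subalgebras; the remaining 3 * 6 cases, with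
   two arguments in A and two in A^*, are up to sign and up to exchanging the
   covectors exactly the 18 conditions of (5). *)

(** * Extensionality and additivity of linear maps *)

Section Hom.
Context {F : fieldType} {U W : vectType F}.
Lemma hom_ext2 (f g : act U W) : (forall x y, f x y = g x y) -> f = g.
Proof. by move=> e; apply/lfunP => x; apply/lfunP => y. Qed.
Lemma hom_appD (f : 'Hom(U, W)) u v : f (u + v) = f u + f v.
Proof. exact: linearD. Qed.
Lemma hom_appN (f : 'Hom(U, W)) u : f (- u) = - f u.
Proof. exact: linearN. Qed.
Lemma hom_app0 (f : 'Hom(U, W)) : f 0 = 0.
Proof. exact: linear0. Qed.
Lemma hom_addE (f g : 'Hom(U, W)) u : (f + g) u = f u + g u.
Proof. exact: add_lfunE. Qed.
Lemma hom_oppE (f : 'Hom(U, W)) u : (- f) u = - f u.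
Proof. exact: opp_lfunE. Qed.
Lemma hom_zeroE u : (0 : 'Hom(U, W)) u = 0.
Proof. exact: zero_lfunE. Qed.
End Hom.

(** * Vertical and horizontal dendriform algebras of a quadri-algebra *)

Section Dendriform.
Context {F : fieldType}.

Lemma vert_star {A : vectType F} (Q : quadriOps A) : dstar (vert Q) = qstar Q.
Proof. by rewrite /dstar /= /qwedge /qvee /qstar !addrA. Qed.

(** The associated horizontal dendriform algebra. Moving arguments of the vertical axioms across an
    invariant form produces the horizontal ones. *)
Definition horiz {A : vectType F} (Q : quadriOps A) : dendriOps A :=
  DendriOps (qprec Q) (qsucc Q).

Lemma horiz_star {A : vectType F} (Q : quadriOps A) : dstar (horiz Q) = qstar Q.
Proof.
by rewrite /dstar /= /qprec /qsucc /qstar addrACA addrA.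
Qed.

Section Evaluation.
Context {A : vectType F} (Q : quadriOps A).

Lemma qwedgeE x y : qwedge Q x y = qnw Q x y + qne Q x y.
Proof. by rewrite !add_lfunE. Qed.
Lemma qveeE x y : qvee Q x y = qsw Q x y + qse Q x y.
Proof. by rewrite !add_lfunE. Qed.
Lemma qsuccE x y : qsucc Q x y = qne Q x y + qse Q x y.
Proof. by rewrite !add_lfunE. Qed.
Lemma qprecE x y : qprec Q x y = qnw Q x y + qsw Q x y.
Proof. by rewrite !add_lfunE. Qed.
Lemma qstarE_vert x y : qstar Q x y = qwedge Q x y + qvee Q x y.
Proof. by rewrite -vert_star /dstar !add_lfunE. Qed.
Lemma qstarE_horiz x y : qstar Q x y = qprec Q x y + qsucc Q x y.
Proof. by rewrite -horiz_star /dstar !add_lfunE. Qed.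

(** The nine axioms stand in three groups of three; the sum of the k-th group is the k-th vertical
    dendriform axiom. *)
Lemma quadri_vert : is_quadri Q -> is_dendriform (vert Q).
Proof.
rewrite /is_dendriform vert_star /= => qQ x y z.
case: (qQ x y z) => -[e1 e2 e3] [e4 e5 e6] [e7 e8 e9]; split.
- rewrite [LHS]qwedgeE e3 [in LHS]qwedgeE linearD add_lfunE e1 e2.
  by rewrite [RHS]qwedgeE -addrA -linearD -(qstarE_horiz y z).
- rewrite [LHS]qwedgeE e6 [in LHS]qveeE linearD add_lfunE e4 e5.
  by rewrite [RHS]qveeE -addrA -linearD -(qwedgeE y z).
- rewrite [LHS]qveeE e9 [in LHS]qstarE_horiz linearD add_lfunE e7 e8.
  by rewrite [RHS]qveeE -addrA -linearD -(qveeE y z).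
Qed.

(** Here the k-th members of the three groups are summed instead. *)
Lemma quadri_horiz : is_quadri Q -> is_dendriform (horiz Q).
Proof.
rewrite /is_dendriform horiz_star /= => qQ x y z.
case: (qQ x y z) => -[e1 e2 e3] [e4 e5 e6] [e7 e8 e9]; split.
- rewrite [LHS]qprecE e7 [in LHS]qprecE linearD add_lfunE e1 e4.
  by rewrite [RHS]qprecE -addrA -linearD -(qstarE_vert y z).
- rewrite [LHS]qprecE e8 [in LHS]qsuccE linearD add_lfunE e2 e5.
  by rewrite [RHS]qsuccE -addrA -linearD -(qprecE y z).
- rewrite [LHS]qsuccE e9 [in LHS]qstarE_vert linearD add_lfunE e3 e6.
  by rewrite [RHS]qsuccE -addrA -linearD -(qsuccE y z).
Qed.
End Evaluation.

Lemma dendriform_starA {A : vectType F} {D : dendriOps A} : is_dendriform D ->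
  forall x y z, dstar D (dstar D x y) z = dstar D x (dstar D y z).
Proof.
move=> dD x y z; case: (dD x y z) => e1 e2 e3.
have sE u v : dstar D u v = dwedge D u v + dvee D u v by rewrite !add_lfunE.
rewrite [LHS]sE e3 [in dwedge D _ _]sE linearD add_lfunE e1 e2.
by rewrite [RHS]sE [in X in _ = _ + X]sE linearD addrA.
Qed.

End Dendriform.

(** * Invariant forms and 2-cocycles *)

Section Forms.
Context {F : fieldType} {V : vectType F} {B : 'Hom(V, dual V)}.

(** A space and its dual have equal dimension, so an injective form represents every functional. *)
Lemma injective_invK : injective B -> cancel (B^-1)%VF B.
Proof.
move=> injB p; apply: limg_lfunVK.
suff -> : limg B = fullv by rewrite memvf.
apply/eqP; rewrite eqEdim subvf /= limg_dim_eq ?dimvf ?dim_dual //.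
by apply/eqP; rewrite capfv; apply/lker0P.
Qed.

Definition adj (o : bilop V) : bilop V :=
  mkbil (fun x y => (B^-1)%VF (dualrep o y (B x))).

Lemma adjE (o : bilop V) : injective B ->
  forall x y z, B (adj o x y) z = B x (o y z).
Proof.
move=> injB x y z; rewrite mkbilE ?injective_invK ?dualrepE //.
- by move=> {}x k v w; rewrite linearP add_lfunE scale_lfunE linearP.
- by move=> {}y k v w; rewrite !linearP.
Qed.

Section Invariant.
Context {Q : quadriOps V} (iQ : invariant_form Q B).
Let symB u v : B u v = B v u := iQ.1 u v.

(** In the names below, the final [l] or [r] tells which argument stays on the left of the form.
    Left transposition permutes the nine products in three signed 3-cycles:
    [nw -> star -> se -> nw], [prec -> vee -> -ne -> prec] and [succ -> -sw -> wedge -> succ]. Right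
    transposition runs through the same cycles backwards. *)
Lemma inv_nwl x y z : B (qnw Q x y) z = B x (qstar Q y z).
Proof. by case: (iQ.2 x y z). Qed.
Lemma inv_ner x y z : B (qne Q x y) z = - B y (qvee Q z x).
Proof. by case: (iQ.2 x y z). Qed.
Lemma inv_swl x y z : B (qsw Q x y) z = - B x (qwedge Q y z).
Proof. by case: (iQ.2 x y z). Qed.
Lemma inv_ser x y z : B (qse Q x y) z = B y (qstar Q z x).
Proof. by case: (iQ.2 x y z). Qed.

Lemma inv_sel x y z : B (qse Q x y) z = B x (qnw Q y z).
Proof. by rewrite inv_ser -inv_nwl symB. Qed.
Lemma inv_starl x y z : B (qstar Q x y) z = B x (qse Q y z).
Proof. by rewrite [RHS]symB inv_ser symB. Qed.
Lemma inv_precl x y z : B (qprec Q x y) z = B x (qvee Q y z).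
Proof.
rewrite /qprec add_lfunE add_lfunE linearD add_lfunE inv_nwl inv_swl.
by rewrite qstarE_vert linearD addrAC subrr add0r.
Qed.
Lemma inv_nel x y z : B (qne Q x y) z = - B x (qprec Q y z).
Proof. by rewrite inv_ner -inv_precl [in RHS]symB. Qed.
Lemma inv_veel x y z : B (qvee Q x y) z = - B x (qne Q y z).
Proof. by rewrite [in RHS]symB inv_ner opprK symB. Qed.
Lemma inv_succl x y z : B (qsucc Q x y) z = - B x (qsw Q y z).
Proof.
rewrite /qsucc !add_lfunE linearD add_lfunE inv_nel inv_sel /qprec !add_lfunE.
by rewrite linearD opprD addrAC addNr add0r.
Qed.
Lemma inv_wedgel x y z : B (qwedge Q x y) z = B x (qsucc Q y z).
Proof. by rewrite [RHS]symB inv_succl [in RHS]symB inv_swl opprK symB. Qed.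

Lemma inv_nwr x y z : B (qnw Q x y) z = B y (qse Q z x).
Proof. by rewrite inv_nwl symB inv_starl. Qed.
Lemma inv_swr x y z : B (qsw Q x y) z = - B y (qsucc Q z x).
Proof. by rewrite inv_swl symB inv_wedgel. Qed.
Lemma inv_wedger x y z : B (qwedge Q x y) z = - B y (qsw Q z x).
Proof. by rewrite inv_wedgel symB inv_succl. Qed.
Lemma inv_veer x y z : B (qvee Q x y) z = B y (qprec Q z x).
Proof. by rewrite inv_veel symB inv_nel opprK. Qed.
Lemma inv_succr x y z : B (qsucc Q x y) z = B y (qwedge Q z x).
Proof. by rewrite inv_succl symB inv_swl opprK. Qed.
Lemma inv_precr x y z : B (qprec Q x y) z = - B y (qne Q z x).
Proof. by rewrite inv_precl symB inv_veel. Qed.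
Lemma inv_starr x y z : B (qstar Q x y) z = B y (qnw Q z x).
Proof. by rewrite inv_starl symB inv_sel. Qed.

(** Once [x] is moved to the left slot everywhere, the identity reads [qvee = qsw + qse]. *)
Lemma invariant_cocycle : two_cocycle (vert Q) B.
Proof.
split=> // x y z; rewrite vert_star /= inv_starl [B y _]symB inv_wedger.
by rewrite /qvee !add_lfunE linearD addKr.
Qed.

(** Paired with [w] and transposed, both sides of each axiom involve only [qwedge], [qvee] and
    [qstar]. Three axioms become associativity of [qstar], and each vertical axiom accounts for two
    of the other six. *)
Lemma dendriform_quadri : injective B -> is_dendriform (vert Q) -> is_quadri Q.
Proof.
move=> injB dD x y z.
have starA := dendriform_starA dD; rewrite vert_star in starA.
have d1 u v w : qwedge Q (qwedge Q u v) w = qwedge Q u (qstar Q v w).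
  by case: (dD u v w); rewrite vert_star.
have d2 u v w : qwedge Q (qvee Q u v) w = qvee Q u (qwedge Q v w).
  by case: (dD u v w).
have d3 u v w : qvee Q (qstar Q u v) w = qvee Q u (qvee Q v w).
  by case: (dD u v w); rewrite vert_star.
have ext u v : (forall w, B u w = B v w) -> u = v.
  by move=> e; apply/injB/lfunP.
split; split; apply: ext => w.
- by rewrite !inv_nwl starA.
- by rewrite inv_nwl !inv_ner inv_precl d3.
- by rewrite !inv_ner inv_succr d2.
- by rewrite inv_nwl !inv_swl d1.
- by rewrite inv_nwl !inv_ser inv_nwl starA.
- by rewrite inv_ser !inv_ner d3.
- by rewrite !inv_swl inv_precl d2.
- by rewrite inv_ser !inv_swl inv_succr d1.
- by rewrite !inv_ser starA.
Qed.

(* The three axioms at (u, v, w), paired with t and transposed so that each side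
   only involves products of two arguments. *)
Definition invariant_dendriform u v w t : Prop :=
  [/\ B (qwedge Q u v) (qsucc Q w t) = - B (qstar Q v w) (qsw Q t u),
      B (qvee Q u v) (qsucc Q w t) = B (qwedge Q v w) (qprec Q t u)
    & - B (qstar Q u v) (qne Q w t) = B (qvee Q v w) (qprec Q t u)].

Lemma dendriform_invariantP : injective B ->
  is_dendriform (vert Q) <-> forall u v w t, invariant_dendriform u v w t.
Proof.
move=> injB; split=> [dD u v w t | E].
  case: (dD u v w); rewrite vert_star /= => e1 e2 e3.
  split; first by rewrite -inv_wedgel e1 inv_wedger.
    by rewrite -inv_wedgel e2 inv_veer.
  by rewrite -inv_veel e3 inv_veer.
rewrite /is_dendriform vert_star /= => u v w.
by split; apply/injB/lfunP => t; case: (E u v w t) => e1 e2 e3;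
  [ rewrite inv_wedgel e1 -inv_wedger | rewrite inv_wedgel e2 -inv_veer
  | rewrite inv_veel e3 -inv_veer].
Qed.

Ltac additive_axioms :=
  rewrite /invariant_dendriform;
  (* The products are generalized, since [hom_addE] would otherwise unfold them into sums of
     arrows. *)
  move: (qwedge Q) (qvee Q) (qstar Q) (qsucc Q) (qprec Q) => ? ? ? ? ?;
  move=> [? ? ?] [? ? ?]; split; rewrite !(hom_appD, hom_addE, opprD);
  by congr (_ + _).

Lemma invariant_dendriformD1 t u u' v w :
  invariant_dendriform u v w t -> invariant_dendriform u' v w t ->
  invariant_dendriform (u + u') v w t.
Proof. additive_axioms. Qed.

Lemma invariant_dendriformD2 t u v v' w :
  invariant_dendriform u v w t -> invariant_dendriform u v' w t ->
  invariant_dendriform u (v + v') w t.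
Proof. additive_axioms. Qed.

Lemma invariant_dendriformD3 t u v w w' :
  invariant_dendriform u v w t -> invariant_dendriform u v w' t ->
  invariant_dendriform u v (w + w') t.
Proof. additive_axioms. Qed.

Lemma invariant_dendriformD4 t t' u v w :
  invariant_dendriform u v w t -> invariant_dendriform u v w t' ->
  invariant_dendriform u v w (t + t').
Proof. additive_axioms. Qed.

End Invariant.

(** The four arrows are defined by the invariance equations, which nondegeneracy makes solvable. The
    cocycle identity serves to recover [D] as the vertical part. *)
Lemma cocycle_splitting {D : dendriOps V} : injective B -> two_cocycle D B ->
  exists2 Q : quadriOps V, invariant_form Q B & vert Q = D.
Proof.
move=> injB [symB cD].
(* Flipping the operation before and after [adj] turns the left transpose into the right one. *)
have ropE o x y z : B (Rop (adj (Rop o)) x y) z = B y (o z x).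
  by rewrite RopE adjE // RopE.
pose nw := adj (dstar D); pose ne := - Rop (adj (Rop (dvee D))).
pose sw := - adj (dwedge D); pose se := Rop (adj (Rop (dstar D))).
have nwE x y z : B (nw x y) z = B x (dstar D y z) by rewrite adjE.
have seE x y z : B (se x y) z = B y (dstar D z x) by rewrite ropE.
have neE x y z : B (ne x y) z = - B y (dvee D z x).
  by rewrite /ne !opp_lfunE linearN opp_lfunE ropE.
have swE x y z : B (sw x y) z = - B x (dwedge D y z).
  by rewrite /sw !opp_lfunE linearN opp_lfunE adjE.
(* The cocycle identity at [(y, z, x)]; for [veeE] below it is taken at [(z, x, y)]. *)
have wedgeE : nw + ne = dwedge D.
  apply/lfunP => x; apply/lfunP => y; apply/injB/lfunP => z.
  by rewrite !add_lfunE linearD add_lfunE nwE neE [B x _]symB cD addrK symB.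
have veeE : sw + se = dvee D.
  apply/lfunP => x; apply/lfunP => y; apply/injB/lfunP => z.
  by rewrite !add_lfunE linearD add_lfunE swE seE [B y _]symB cD addKr symB.
set Q := QuadriOps nw ne sw se.
have vE : vert Q = D by rewrite /vert /qwedge /qvee /= wedgeE veeE; case: (D).
exists Q => //; split=> // x y z.
rewrite -vert_star -[qvee Q]/(dvee (vert Q)) -[qwedge Q]/(dwedge (vert Q)) vE.
by split.
Qed.

End Forms.

(** * The axioms with three arguments in a quadri-subalgebra *)

Section SubalgebraVanishing.
Context {F : fieldType} {V X : vectType F} {B : 'Hom(V, dual V)}.
Context {Q : quadriOps V} (iQ : invariant_form Q B).
Context {P : quadriOps X} (qP : is_quadri P) {i : X -> V}.
Hypotheses (iD : {morph i : x y / x + y}) (homi : quadri_hom P Q i).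
Let symB u v : B u v = B v u := iQ.1 u v.

Lemma hom_wedge x y : i (qwedge P x y) = qwedge Q (i x) (i y).
Proof. by rewrite !add_lfunE iD; case: (homi x y) => -> -> _ _. Qed.
Lemma hom_vee x y : i (qvee P x y) = qvee Q (i x) (i y).
Proof. by rewrite !add_lfunE iD; case: (homi x y) => _ _ -> ->. Qed.
Lemma hom_succ x y : i (qsucc P x y) = qsucc Q (i x) (i y).
Proof. by rewrite !add_lfunE iD; case: (homi x y) => _ -> _ ->. Qed.
Lemma hom_prec x y : i (qprec P x y) = qprec Q (i x) (i y).
Proof. by rewrite !add_lfunE iD; case: (homi x y) => -> _ -> _. Qed.
Lemma hom_star x y : i (qstar P x y) = qstar Q (i x) (i y).
Proof. by rewrite !qstarE_vert iD hom_wedge hom_vee. Qed.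

(** Moving the free vector [m] alone into one slot of the form leaves an identity inside the
    subalgebra. With [m] last these are the three vertical axioms; the other positions give the
    three horizontal axioms and six of the nine quadri-algebra axioms. *)
Lemma invariant_dendriform_sub x y z m :
  [/\ invariant_dendriform (B := B) (Q := Q) m (i x) (i y) (i z),
      invariant_dendriform (B := B) (Q := Q) (i z) m (i x) (i y),
      invariant_dendriform (B := B) (Q := Q) (i y) (i z) m (i x)
    & invariant_dendriform (B := B) (Q := Q) (i x) (i y) (i z) m].
Proof.
have nwE u v : i (qnw P u v) = qnw Q (i u) (i v) by case: (homi u v).
have neE u v : i (qne P u v) = qne Q (i u) (i v) by case: (homi u v).
have swE u v : i (qsw P u v) = qsw Q (i u) (i v) by case: (homi u v).
have seE u v : i (qse P u v) = qse Q (i u) (i v) by case: (homi u v).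
case: (qP x y z) => -[e1 e2 e3] [e4 e5 e6] [e7 e8 e9].
have := quadri_vert _ qP x y z; rewrite vert_star /= => -[v1 v2 v3].
have := quadri_horiz _ qP x y z; rewrite horiz_star /= => -[h1 h2 h3].
split; split.
- rewrite inv_wedgel // [in RHS]symB (inv_swr iQ) opprK.
  by rewrite -!(hom_succ, hom_star) h3.
- by rewrite inv_veel // [in RHS]symB inv_precr //
  -!(hom_succ, hom_wedge, neE) e3.
- rewrite inv_starl // [in RHS]symB inv_precr //.
  by rewrite -!(hom_vee, neE, seE) e6.
- by rewrite inv_wedger // inv_starl // -!(hom_succ, swE, seE) e8.
- by rewrite inv_veer // inv_wedgel // -!(hom_succ, hom_prec) h2.
- by rewrite inv_starr // inv_veel // -!(neE, nwE, hom_prec) e2.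
- rewrite symB inv_succl // inv_starr //.
  by rewrite -!(hom_wedge, swE, nwE) e4.
- rewrite symB inv_succl // inv_wedger //.
  by rewrite -!(hom_vee, swE, hom_prec) e7.
- rewrite symB inv_nel // inv_veer // opprK.
  by rewrite -!(hom_star, hom_prec) h1.
- rewrite symB inv_succr // [in RHS]symB inv_swl // opprK.
  by rewrite -!(hom_wedge, hom_star) v1.
- rewrite symB inv_succr // [in RHS]symB inv_precl //.
  by rewrite -!(hom_wedge, hom_vee) v2.
- rewrite symB inv_ner // opprK [in RHS]symB inv_precl //.
  by rewrite -!(hom_vee, hom_star) v3.
Qed.
End SubalgebraVanishing.

(** * Splitting of a 2-cocycle and quadri-algebra morphisms *)

Section Splitting.
Context {F : fieldType} {V X : vectType F} {B : 'Hom(V, dual V)}.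
Context {Q : quadriOps V} {P : quadriOps X} {i : X -> V}.

(** The right-hand sides in [splits_by] are those of invariance, so they are the values of the
    products of [Q], and injectivity of [B] compares the products themselves. *)
Lemma splits_byP : injective B -> invariant_form Q B ->
  splits_by B (vert Q) P i <-> quadri_hom P Q i.
Proof.
move=> injB iQ; rewrite /splits_by vert_star /=.
split=> [h x y | h x y w].
  by split; apply/injB/lfunP => w; case: (h x y w) => h1 h2 h3 h4;
    rewrite (h1, h2, h3, h4) (inv_nwl iQ, inv_ner iQ, inv_swl iQ, inv_ser iQ).
case: (h x y) => -> -> -> ->.
by rewrite (inv_nwl iQ) (inv_ner iQ) (inv_swl iQ) (inv_ser iQ).
Qed.

Lemma quadri_hom_vert : {morph i : x y / x + y} -> quadri_hom P Q i ->
  dendri_hom (vert P) (vert Q) i.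
Proof. by move=> iD h x y; rewrite /= (hom_wedge iD h) (hom_vee iD h). Qed.
End Splitting.

(** * Uniqueness of an invariant extension *)

Section InvariantExtension.
Context {F : fieldType} {V X Y : vectType F} {B : 'Hom(V, dual V)}.
Context {i : X -> V} {j : Y -> V}.
Hypotheses (injB : injective B) (ij : forall v, exists x y, v = i x + j y).

(** Each of [u], [v], [w] splits into two components. In each of the eight resulting terms two of
    the three vectors lie in the same summand, and passing to the left transpose [h] or the right
    transpose [g] makes these two the factors of the product. *)
Lemma cyclic_op_unique (f g h f' g' h' : bilop V) :
    (forall u v w, B (f u v) w = B u (h v w)) ->
    (forall u v w, B (f u v) w = B v (g w u)) ->
    (forall u v w, B (f' u v) w = B u (h' v w)) ->
    (forall u v w, B (f' u v) w = B v (g' w u)) ->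
    (forall x y, [/\ f (i x) (i y) = f' (i x) (i y),
                  g (i x) (i y) = g' (i x) (i y)
                   & h (i x) (i y) = h' (i x) (i y)]) ->
    (forall x y, [/\ f (j x) (j y) = f' (j x) (j y),
                  g (j x) (j y) = g' (j x) (j y)
                   & h (j x) (j y) = h' (j x) (j y)]) ->
  f = f'.
Proof.
move=> fl fr fl' fr' eqi eqj; apply: hom_ext2 => u v; apply/injB/lfunP => w.
case: (ij u) => x [a ->]; case: (ij v) => y [b ->]; case: (ij w) => z [c ->].
rewrite !(hom_appD, hom_addE).
congr (_ + _ + (_ + _) + (_ + _ + (_ + _))).
- by case: (eqi x y) => ->.
- by rewrite fl fl'; case: (eqi y z) => _ _ ->.
- by rewrite fr fr'; case: (eqi z x) => _ ->.
- by case: (eqj a b) => ->.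
- by case: (eqi x y) => ->.
- by rewrite fr fr'; case: (eqj c a) => _ ->.
- by rewrite fl fl'; case: (eqj b c) => _ _ ->.
- by case: (eqj a b) => ->.
Qed.

(** Both structures restrict to [P] and [P'], so all nine products agree on each image. Each arrow
    is then treated together with its signed right and left transposes. *)
Lemma invariant_extension_unique (P : quadriOps X) (P' : quadriOps Y)
    (Q Q' : quadriOps V) :
    {morph i : x y / x + y} -> {morph j : x y / x + y} ->
    invariant_form Q B -> invariant_form Q' B ->
    quadri_hom P Q i -> quadri_hom P' Q j ->
    quadri_hom P Q' i -> quadri_hom P' Q' j ->
  Q = Q'.
Proof.
move=> iD jD iQ iQ' hi hj hi' hj'.
have agree (Z : vectType F) (k : Z -> V) (R : quadriOps Z) :
    {morph k : x y / x + y} -> quadri_hom R Q k -> quadri_hom R Q' k ->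
  forall x y (u := k x) (v := k y),
    [/\ [/\ qnw Q u v = qnw Q' u v, qne Q u v = qne Q' u v,
            qsw Q u v = qsw Q' u v & qse Q u v = qse Q' u v],
        [/\ qwedge Q u v = qwedge Q' u v, qvee Q u v = qvee Q' u v,
            qsucc Q u v = qsucc Q' u v & qprec Q u v = qprec Q' u v]
      & qstar Q u v = qstar Q' u v].
  move=> kD h h' x y u v; rewrite /u /v.
  rewrite -(hom_wedge kD h) -(hom_wedge kD h') -(hom_vee kD h) -(hom_vee kD h').
  rewrite -(hom_succ kD h) -(hom_succ kD h') -(hom_prec kD h) -(hom_prec kD h').
  rewrite -(hom_star kD h) -(hom_star kD h').
  by case: (h x y) => <- <- <- <-; case: (h' x y) => <- <- <- <-.
have agi := agree _ _ _ iD hi hi'; have agj := agree _ _ _ jD hj hj'.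
suff [nwE neE swE seE] :
  [/\ qnw Q = qnw Q', qne Q = qne Q', qsw Q = qsw Q' & qse Q = qse Q'].
  by case: (Q) (Q') nwE neE swE seE => ? ? ? ? [? ? ? ?] /= -> -> -> ->.
split.
- apply: (cyclic_op_unique _ (qse Q) (qstar Q)
            _ (qse Q') (qstar Q'))
      => [u v w|u v w|u v w|u v w|x y|x y].
  + by rewrite (inv_nwl iQ).
  + by rewrite (inv_nwr iQ).
  + by rewrite (inv_nwl iQ').
  + by rewrite (inv_nwr iQ').
  + by case: (agi x y) => -[? ? ? ?] [? ? ? ?] ?;
      split; rewrite ?hom_oppE //; congr (- _).
  + by case: (agj x y) => -[? ? ? ?] [? ? ? ?] ?;
      split; rewrite ?hom_oppE //; congr (- _).
- apply: (cyclic_op_unique _ (- qvee Q) (- qprec Q)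
            _ (- qvee Q') (- qprec Q'))
      => [u v w|u v w|u v w|u v w|x y|x y].
  + by rewrite (inv_nel iQ) !hom_oppE hom_appN.
  + by rewrite (inv_ner iQ) !hom_oppE hom_appN.
  + by rewrite (inv_nel iQ') !hom_oppE hom_appN.
  + by rewrite (inv_ner iQ') !hom_oppE hom_appN.
  + by case: (agi x y) => -[? ? ? ?] [? ? ? ?] ?;
      split; rewrite ?hom_oppE //; congr (- _).
  + by case: (agj x y) => -[? ? ? ?] [? ? ? ?] ?;
      split; rewrite ?hom_oppE //; congr (- _).
- apply: (cyclic_op_unique _ (- qsucc Q) (- qwedge Q)
            _ (- qsucc Q') (- qwedge Q'))
      => [u v w|u v w|u v w|u v w|x y|x y].
  + by rewrite (inv_swl iQ) !hom_oppE hom_appN.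
  + by rewrite (inv_swr iQ) !hom_oppE hom_appN.
  + by rewrite (inv_swl iQ') !hom_oppE hom_appN.
  + by rewrite (inv_swr iQ') !hom_oppE hom_appN.
  + by case: (agi x y) => -[? ? ? ?] [? ? ? ?] ?;
      split; rewrite ?hom_oppE //; congr (- _).
  + by case: (agj x y) => -[? ? ? ?] [? ? ? ?] ?;
      split; rewrite ?hom_oppE //; congr (- _).
- apply: (cyclic_op_unique _ (qstar Q) (qnw Q)
            _ (qstar Q') (qnw Q'))
      => [u v w|u v w|u v w|u v w|x y|x y].
  + by rewrite (inv_sel iQ).
  + by rewrite (inv_ser iQ).
  + by rewrite (inv_sel iQ').
  + by rewrite (inv_ser iQ').
  + by case: (agi x y) => -[? ? ? ?] [? ? ? ?] ?;
      split; rewrite ?hom_oppE //; congr (- _).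
  + by case: (agj x y) => -[? ? ? ?] [? ? ? ?] ?;
      split; rewrite ?hom_oppE //; congr (- _).
Qed.
End InvariantExtension.

(** * Equivalences of equations *)

Section Logic.
Lemma and3_iff (P1 P2 P3 Q1 Q2 Q3 : Prop) :
  (P1 <-> Q1) -> (P2 <-> Q2) -> (P3 <-> Q3) ->
  [/\ P1, P2 & P3] <-> [/\ Q1, Q2 & Q3].
Proof. by move=> h1 h2 h3; split=> -[] /h1 ? /h2 ? /h3. Qed.

(** Reduces an equivalence of two equations to one identity that [ring] can decide; the variant
    below absorbs a change of sign. *)
Lemma sub_eq_iff (F : fieldType) (a b c d : F) : a - b = c - d -> a = b <-> c = d.
Proof.
move=> h; have hb : (a == b) = (c == d) by rewrite -subr_eq0 h subr_eq0.
by split=> /eqP; [rewrite hb | rewrite -hb] => /eqP.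
Qed.

Lemma sub_eq_iffN (F : fieldType) (a b c d : F) :
  a - b = d - c -> a = b <-> c = d.
Proof.
move=> h; have [h1 h2] := sub_eq_iff _ _ _ _ _ h.
by split=> [/h1 | /esym /h2].
Qed.
End Logic.

(** * Relations among the products, in the form in which the transposes of two summands add up *)

Section Identities.
Context {F : fieldType} {V : vectType F} (Q : quadriOps V).
Lemma q_se_vee : qse Q - qvee Q = - qsw Q.
Proof. by rewrite /qvee opprD addrCA subrr addr0. Qed.
Lemma q_star_prec : qstar Q - qprec Q = qsucc Q.
Proof. by rewrite -horiz_star /dstar addrAC subrr add0r. Qed.
Lemma q_star_succ : - qsucc Q + qstar Q = qprec Q.
Proof. by rewrite -horiz_star /dstar addrC addrK. Qed.
Lemma q_nw_wedge : - qwedge Q + qnw Q = - qne Q.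
Proof. by rewrite /qwedge opprD addrAC addNr add0r. Qed.
Lemma q_prec_sw : - qsw Q + qprec Q = qnw Q.
Proof. by rewrite /qprec addrC addrK. Qed.
Lemma q_succ_ne : qsucc Q - qne Q = qse Q.
Proof. by rewrite /qsucc addrAC subrr add0r. Qed.
Lemma q_se_succ : qse Q - qsucc Q = - qne Q.
Proof. by rewrite /qsucc opprD addrCA subrr addr0. Qed.
Lemma q_star_wedge : qstar Q - qwedge Q = qvee Q.
Proof. by rewrite -vert_star /dstar addrAC subrr add0r. Qed.
Lemma q_star_vee : - qvee Q + qstar Q = qwedge Q.
Proof. by rewrite -vert_star /dstar addrC addrK. Qed.
Lemma q_nw_prec : - qprec Q + qnw Q = - qsw Q.
Proof. by rewrite /qprec opprD addrAC addNr add0r. Qed.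
End Identities.

(** * Bowtie operations built from transposes *)

(* C stands for A^*, e for the pairing, TR o and TL o for the transposes R_o^* and
   L_o^* of the multiplications on A, SR and SL for the same with A and C exchanged.
   Keeping C abstract makes A and A^* symmetric. *)
Section CyclicBowtie.
Context {F : fieldType} {A C : vectType F} (e : A -> C -> F).
Hypotheses (eDl : forall x y c, e (x + y) c = e x c + e y c)
           (eDr : forall x b c, e x (b + c) = e x b + e x c)
           (e_sepl : forall x y, (forall c, e x c = e y c) -> x = y)
           (e_sepr : forall b c, (forall x, e x b = e x c) -> b = c).
Context (TR TL : bilop A -> act A C) (SR SL : bilop C -> act C A).
Hypotheses (TRE : forall o x c y, e y (TR o x c) = e (o y x) c)
           (TLE : forall o x c y, e y (TL o x c) = e (o x y) c)
           (SRE : forall s a x c, e (SR s a x) c = e x (s c a))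
           (SLE : forall s a x c, e (SL s a x) c = e x (s a c)).
Context (B : 'Hom((A * C)%type, dual (A * C)%type)).
Hypothesis BE : forall x a y b, B (x, a) (y, b) = e y a + e x b.
Implicit Types (o r l : bilop A) (os rs ls : bilop C).

Lemma pair_0l c : e 0 c = 0.
Proof. by apply: (addrI (e 0 c)); rewrite -eDl !addr0. Qed.
Lemma pair_0r x : e x 0 = 0.
Proof. by apply: (addrI (e x 0)); rewrite -eDr !addr0. Qed.
Lemma pair_Nl x c : e (- x) c = - e x c.
Proof. by apply: (addrI (e x c)); rewrite -eDl !subrr pair_0l. Qed.
Lemma pair_Nr x c : e x (- c) = - e x c.
Proof. by apply: (addrI (e x c)); rewrite -eDr !subrr pair_0r. Qed.

Lemma TRD o1 o2 : TR (o1 + o2) = TR o1 + TR o2.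
Proof.
by apply: hom_ext2 => x c; apply: e_sepr => y;
  rewrite !hom_addE eDr !TRE !hom_addE eDl.
Qed.
Lemma TLD o1 o2 : TL (o1 + o2) = TL o1 + TL o2.
Proof.
by apply: hom_ext2 => x c; apply: e_sepr => y;
  rewrite !hom_addE eDr !TLE !hom_addE eDl.
Qed.
Lemma SRD (s1 s2 : bilop C) : SR (s1 + s2) = SR s1 + SR s2.
Proof.
by apply: hom_ext2 => x c; apply: e_sepl => y;
  rewrite !hom_addE eDl !SRE !hom_addE eDr.
Qed.
Lemma SLD (s1 s2 : bilop C) : SL (s1 + s2) = SL s1 + SL s2.
Proof.
by apply: hom_ext2 => x c; apply: e_sepl => y;
  rewrite !hom_addE eDl !SLE !hom_addE eDr.
Qed.
Lemma TRN o : TR (- o) = - TR o.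
Proof.
by apply: hom_ext2 => x c; apply: e_sepr => y;
  rewrite !hom_oppE pair_Nr !TRE !hom_oppE pair_Nl.
Qed.
Lemma TLN o : TL (- o) = - TL o.
Proof.
by apply: hom_ext2 => x c; apply: e_sepr => y;
  rewrite !hom_oppE pair_Nr !TLE !hom_oppE pair_Nl.
Qed.
Lemma SRN (s : bilop C) : SR (- s) = - SR s.
Proof.
by apply: hom_ext2 => x c; apply: e_sepl => y;
  rewrite !hom_oppE pair_Nl !SRE !hom_oppE pair_Nr.
Qed.
Lemma SLN (s : bilop C) : SL (- s) = - SL s.
Proof.
by apply: hom_ext2 => x c; apply: e_sepl => y;
  rewrite !hom_oppE pair_Nl !SLE !hom_oppE pair_Nr.
Qed.

(* r and l are the right and left transposes of o for B: B (x o y) z = B y (z r x)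
   and B (x o y) z = B x (y l z); see cbowtie_invl. *)
Definition cbowtie o r l os rs ls : bilop (A * C)%type :=
  bowtie_op o os (TR r) (TL l) (SR rs) (SL ls).

Lemma cbowtieD o1 r1 l1 os1 rs1 ls1 o2 r2 l2 os2 rs2 ls2 :
  cbowtie (o1 + o2) (r1 + r2) (l1 + l2) (os1 + os2) (rs1 + rs2) (ls1 + ls2) =
  cbowtie o1 r1 l1 os1 rs1 ls1 + cbowtie o2 r2 l2 os2 rs2 ls2.
Proof.
apply: hom_ext2 => -[x a] [y b]; rewrite !hom_addE !bowtie_opE.
rewrite !(TRD, TLD, SRD, SLD) !hom_addE.
by congr (_, _); rewrite /= [RHS]addrACA [X in _ = X + _]addrACA.
Qed.

Lemma cbowtieN o r l os rs ls :
  cbowtie (- o) (- r) (- l) (- os) (- rs) (- ls) = - cbowtie o r l os rs ls.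
Proof.
apply: hom_ext2 => -[x a] [y b]; rewrite !hom_oppE !bowtie_opE.
rewrite !(TRN, TLN, SRN, SLN) !hom_oppE.
by congr (_, _); rewrite /= !opprD.
Qed.

(** Both sides expand into six terms, one for each way of spreading three vectors over both
    summands; in each term the two vectors of the same summand are multiplied. Left transposition
    thus only rotates [o, r, l] to [l, o, r]. *)
Lemma cbowtie_invl o r l os rs ls u v w :
  B (cbowtie o r l os rs ls u v) w = B u (cbowtie l o r ls os rs v w).
Proof.
case: u v w => [x a] [y b] [z c]; rewrite !bowtie_opE !BE.
rewrite !(eDl, eDr) !(TRE, TLE, SRE, SLE).
by ring.
Qed.

(** * The bowtie quadri-operations and their mixed identities *)

Section CyclicQuadri.
Context (Q : quadriOps A) (S : quadriOps C).

(** Each line lists an arrow with its right and left transposes, as dictated by the 3-cycles of an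
    invariant form. *)
Definition cquadri : quadriOps (A * C)%type := QuadriOps
  (cbowtie (qnw Q) (qse Q) (qstar Q) (qnw S) (qse S) (qstar S))
  (cbowtie (qne Q) (- qvee Q) (- qprec Q) (qne S) (- qvee S) (- qprec S))
  (cbowtie (qsw Q) (- qsucc Q) (- qwedge Q) (qsw S) (- qsucc S) (- qwedge S))
  (cbowtie (qse Q) (qstar Q) (qnw Q) (qse S) (qstar S) (qnw S)).

Lemma cquadri_wedge : qwedge cquadri =
  cbowtie (qwedge Q) (- qsw Q) (qsucc Q) (qwedge S) (- qsw S) (qsucc S).
Proof. by rewrite [LHS]/qwedge /= -cbowtieD !q_se_vee !q_star_prec. Qed.

Lemma cquadri_vee : qvee cquadri =
  cbowtie (qvee Q) (qprec Q) (- qne Q) (qvee S) (qprec S) (- qne S).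
Proof. by rewrite [LHS]/qvee /= -cbowtieD !q_star_succ !q_nw_wedge. Qed.

Lemma cquadri_succ : qsucc cquadri =
  cbowtie (qsucc Q) (qwedge Q) (- qsw Q) (qsucc S) (qwedge S) (- qsw S).
Proof. by rewrite [LHS]/qsucc /= -cbowtieD !q_star_vee !q_nw_prec. Qed.

Lemma cquadri_prec : qprec cquadri =
  cbowtie (qprec Q) (- qne Q) (qvee Q) (qprec S) (- qne S) (qvee S).
Proof. by rewrite [LHS]/qprec /= -cbowtieD !q_se_succ !q_star_wedge. Qed.

Lemma cquadri_star : qstar cquadri =
  cbowtie (qstar Q) (qnw Q) (qse Q) (qstar S) (qnw S) (qse S).
Proof.
rewrite -vert_star /dstar /= cquadri_wedge cquadri_vee -cbowtieD.
by rewrite !q_prec_sw !q_succ_ne -![qwedge _ + _]/(dstar (vert _)) !vert_star.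
Qed.

Lemma B_sym u v : B u v = B v u.
Proof. by case: u v => [x a] [y b]; rewrite !BE addrC. Qed.

Lemma B_inj : injective B.
Proof.
move=> [x a] [y b] h.
have h' z c : e z a + e x c = e z b + e y c by rewrite -!BE h.
congr (_, _); [apply: e_sepl => c | apply: e_sepr => z].
  by have := h' 0 c; rewrite !pair_0l !add0r.
by have := h' z 0; rewrite !pair_0r !addr0.
Qed.

Lemma cquadri_invariant : invariant_form cquadri B.
Proof.
split=> [|x y z]; first exact: B_sym.
have BN u v : B u (- v) = - B u v by exact: hom_appN.
(* Signs are pushed into the operations, so that [cbowtie_invl] applies: once for a left transpose,
   twice with symmetry for a right one. *)
rewrite cquadri_star cquadri_vee cquadri_wedge /= -!BN -!hom_oppE
  -!cbowtieN !opprK.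
split.
- by rewrite cbowtie_invl.
- by rewrite cbowtie_invl B_sym cbowtie_invl.
- by rewrite cbowtie_invl.
- by rewrite cbowtie_invl B_sym cbowtie_invl.
Qed.

Lemma cquadri_homl : quadri_hom Q cquadri (fun x => (x, 0)).
Proof.
by move=> x y; split; rewrite bowtie_opE !(hom_app0, hom_zeroE, addr0).
Qed.

Lemma cquadri_homr : quadri_hom S cquadri (fun a => (0, a)).
Proof.
by move=> x y; split; rewrite bowtie_opE !(hom_app0, hom_zeroE, addr0).
Qed.

Local Notation D := (invariant_dendriform (B := B) (Q := cquadri)).

Ltac evalB :=
  rewrite ?(cquadri_wedge, cquadri_vee, cquadri_star, cquadri_succ, cquadri_prec) /=
  !bowtie_opE !(hom_app0, hom_zeroE, addr0, add0r) !BE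
  ?(TRN, TLN, SRN, SLN) ?hom_oppE
  ?(pair_0r, pair_0l) ?(pair_Nl, pair_Nr) ?(SRE, SLE) ?hom_appN ?(pair_Nl, pair_Nr).

(* The letters record which summand contains each of the four arguments. *)
Lemma invariant_dendriform_AACC x y p q :
  D (x, 0) (y, 0) (0, p) (0, q) <->
  [/\ e (qwedge Q x y) (qsucc S p q) =
        e x (qsucc S (TR (qnw Q) y p) q) + e y (qse S p (TL (qwedge Q) x q)),
      e (qvee Q x y) (qsucc S p q) =
        e y (qsucc S p (TL (qvee Q) x q)) + e x (qne S (TR (qsw Q) y p) q)
    & e (qstar Q x y) (qne S p q) =
        e x (qne S (TR (qprec Q) y p) q) + e y (qne S p (TL (qvee Q) x q))].
Proof.
rewrite /invariant_dendriform; apply: and3_iff;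
  [apply: sub_eq_iff | apply: sub_eq_iff | apply: sub_eq_iffN];
  evalB; ring.
Qed.

(** In the four patterns with adjacent pairs the arguments are rotations of [x, y, p, q], so that
    [x] is always multiplied with [y] and [p] with [q]. They give twelve of the eighteen
    conditions. *)
Lemma invariant_dendriform_CCAA x y p q :
  D (0, p) (0, q) (x, 0) (y, 0) <->
  [/\ e (qsucc Q x y) (qwedge S p q) =
        e y (qwedge S p (TL (qse Q) x q)) + e x (qnw S (TR (qsucc Q) y p) q),
      e (qsucc Q x y) (qvee S p q) =
        e y (qvee S p (TL (qsucc Q) x q)) + e x (qsw S (TR (qne Q) y p) q)
    & e (qne Q x y) (qstar S p q) =
        e x (qprec S (TR (qne Q) y p) q) + e y (qvee S p (TL (qne Q) x q))].
Proof.
rewrite /invariant_dendriform; apply: and3_iff;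
  [apply: sub_eq_iff | apply: sub_eq_iff | apply: sub_eq_iffN];
  evalB; ring.
Qed.

Lemma invariant_dendriform_CAAC x y p q :
  D (0, q) (x, 0) (y, 0) (0, p) <->
  [/\ e (qstar Q x y) (qsw S p q) =
        e x (qsw S (TR (qwedge Q) y p) q) + e y (qsw S p (TL (qsucc Q) x q)),
      e (qwedge Q x y) (qprec S p q) =
        e x (qprec S (TR (qwedge Q) y p) q) + e y (qsw S p (TL (qne Q) x q))
    & e (qvee Q x y) (qprec S p q) =
        e y (qprec S p (TL (qse Q) x q)) + e x (qnw S (TR (qvee Q) y p) q)].
Proof.
rewrite /invariant_dendriform; apply: and3_iff;
  [apply: sub_eq_iff | apply: sub_eq_iffN | apply: sub_eq_iffN];
  evalB; ring.
Qed.

Lemma invariant_dendriform_ACCA x y p q :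
  D (y, 0) (0, p) (0, q) (x, 0) <->
  [/\ e (qsw Q x y) (qstar S p q) =
        e x (qwedge S (TR (qsw Q) y p) q) + e y (qsucc S p (TL (qsw Q) x q)),
      e (qprec Q x y) (qwedge S p q) =
        e x (qwedge S (TR (qprec Q) y p) q) + e y (qne S p (TL (qsw Q) x q))
    & e (qprec Q x y) (qvee S p q) =
        e x (qvee S (TR (qnw Q) y p) q) + e y (qse S p (TL (qprec Q) x q))].
Proof.
rewrite /invariant_dendriform; apply: and3_iff;
  [apply: sub_eq_iff | apply: sub_eq_iffN | apply: sub_eq_iffN];
  evalB; ring.
Qed.

(** In the two alternating patterns only mixed products occur. They give the six conditions that
    involve the flip. *)
Lemma invariant_dendriform_ACAC x y p q :
  D (x, 0) (0, q) (y, 0) (0, p) <->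
  [/\ e x (qsucc S q (TR (qwedge Q) y p)) - e x (qsucc S (TL (qse Q) y q) p) =
        e y (qnw S (TL (qwedge Q) x p) q) - e y (qsw S p (TR (qsw Q) x q)),
      e x (qne S (TL (qsucc Q) y q) p) - e x (qne S q (TR (qwedge Q) y p)) =
        e y (qsw S p (TR (qprec Q) x q)) - e y (qsw S (TL (qvee Q) x p) q)
    & e y (qprec S p (TR (qnw Q) x q)) - e y (qprec S (TL (qvee Q) x p) q) =
        e x (qne S (TL (qne Q) y q) p) - e x (qse S q (TR (qvee Q) y p))].
Proof.
rewrite /invariant_dendriform; apply: and3_iff;
  [apply: sub_eq_iff | apply: sub_eq_iff | apply: sub_eq_iff];
  evalB; ring.
Qed.

Lemma invariant_dendriform_CACA x y p q :
  D (0, q) (x, 0) (0, p) (y, 0) <->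
  [/\ e y (qwedge S (TL (qsucc Q) x q) p) - e y (qwedge S q (TR (qnw Q) x p)) =
        e x (qse S p (TR (qsucc Q) y q)) - e x (qsw S (TL (qsw Q) y p) q),
      e x (qprec S (TL (qsw Q) y p) q) + e y (qwedge S (TL (qne Q) x q) p) =
        e y (qvee S q (TR (qsw Q) x p)) + e x (qsucc S p (TR (qne Q) y q))
    & e y (qvee S (TL (qse Q) x q) p) - e y (qvee S q (TR (qprec Q) x p)) =
        e x (qne S p (TR (qne Q) y q)) - e x (qnw S (TL (qprec Q) y p) q)].
Proof.
rewrite /invariant_dendriform; apply: and3_iff;
  [apply: sub_eq_iff | apply: sub_eq_iffN | apply: sub_eq_iff];
  evalB; ring.
Qed.

(* The 18 bialgebra conditions, each paired with p (x) q. *)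
Definition quadri_compatible : Prop :=
  forall x y,
  [/\ [/\ forall p q, e (qstar Q x y) (qsw S p q) =
            e x (qsw S (TR (qwedge Q) y p) q) + e y (qsw S p (TL (qsucc Q) x q)),
          forall p q, e (qstar Q x y) (qne S p q) =
            e x (qne S (TR (qprec Q) y p) q) + e y (qne S p (TL (qvee Q) x q)),
          forall p q, e (qwedge Q x y) (qsucc S p q) =
            e x (qsucc S (TR (qnw Q) y p) q) + e y (qse S p (TL (qwedge Q) x q)),
          forall p q, e (qwedge Q x y) (qprec S p q) =
            e x (qprec S (TR (qwedge Q) y p) q) + e y (qsw S p (TL (qne Q) x q))
        & forall p q, e (qvee Q x y) (qsucc S p q) =
            e y (qsucc S p (TL (qvee Q) x q)) + e x (qne S (TR (qsw Q) y p) q)],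
      [/\ forall p q, e (qvee Q x y) (qprec S p q) =
            e y (qprec S p (TL (qse Q) x q)) + e x (qnw S (TR (qvee Q) y p) q),
          forall p q, e (qsucc Q x y) (qwedge S p q) =
            e y (qwedge S p (TL (qse Q) x q)) + e x (qnw S (TR (qsucc Q) y p) q),
          forall p q, e (qsucc Q x y) (qvee S p q) =
            e y (qvee S p (TL (qsucc Q) x q)) + e x (qsw S (TR (qne Q) y p) q),
          forall p q, e (qprec Q x y) (qwedge S p q) =
            e x (qwedge S (TR (qprec Q) y p) q) + e y (qne S p (TL (qsw Q) x q))
        & forall p q, e (qprec Q x y) (qvee S p q) =
            e x (qvee S (TR (qnw Q) y p) q) + e y (qse S p (TL (qprec Q) x q))],
      [/\ forall p q, e x (qne S (TL (qsucc Q) y q) p)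
              - e x (qne S q (TR (qwedge Q) y p)) =
            e y (qsw S p (TR (qprec Q) x q)) - e y (qsw S (TL (qvee Q) x p) q),
          forall p q, e y (qprec S p (TR (qnw Q) x q))
            - e y (qprec S (TL (qvee Q) x p) q) =
            e x (qne S (TL (qne Q) y q) p) - e x (qse S q (TR (qvee Q) y p)),
          forall p q, e x (qsucc S q (TR (qwedge Q) y p))
            - e x (qsucc S (TL (qse Q) y q) p) =
            e y (qnw S (TL (qwedge Q) x p) q) - e y (qsw S p (TR (qsw Q) x q)),
          forall p q, e y (qwedge S (TL (qsucc Q) x q) p)
              - e y (qwedge S q (TR (qnw Q) x p)) =
            e x (qse S p (TR (qsucc Q) y q)) - e x (qsw S (TL (qsw Q) y p) q)
        & forall p q, e y (qvee S (TL (qse Q) x q) p)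
              - e y (qvee S q (TR (qprec Q) x p)) =
            e x (qne S p (TR (qne Q) y q)) - e x (qnw S (TL (qprec Q) y p) q)]
    & [/\ forall p q, e (qsw Q x y) (qstar S p q) =
            e x (qwedge S (TR (qsw Q) y p) q) + e y (qsucc S p (TL (qsw Q) x q)),
          forall p q, e (qne Q x y) (qstar S p q) =
            e x (qprec S (TR (qne Q) y p) q) + e y (qvee S p (TL (qne Q) x q))
        & forall p q, e x (qprec S (TL (qsw Q) y p) q)
              + e y (qwedge S (TL (qne Q) x q) p) =
            e y (qvee S q (TR (qsw Q) x p)) + e x (qsucc S p (TR (qne Q) y q))]].

Lemma pair_decomp (x : A) (a : C) : (x, a) = (x, 0) + (0, a) :> (A * C)%type.
Proof. by congr (_, _); rewrite /= ?addr0 ?add0r. Qed.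

Let inl (x : A) : (A * C)%type := (x, 0).
Let inr (a : C) : (A * C)%type := (0, a).

Lemma inl_morph : {morph inl : x y / x + y}.
Proof. by move=> x y; congr (_, _); rewrite /= addr0. Qed.

Lemma inr_morph : {morph inr : a b / a + b}.
Proof. by move=> a b; congr (_, _); rewrite /= addr0. Qed.

Lemma invariant_dendriform_cquadri (qQ : is_quadri Q) (qS : is_quadri S) :
  is_dendriform (vert cquadri) <-> quadri_compatible.
Proof.
have iQ := cquadri_invariant.
split.
  move=> /(dendriform_invariantP iQ B_inj) E x y.
  have aacc p q := (invariant_dendriform_AACC x y p q).1 (E _ _ _ _).
  have ccaa p q := (invariant_dendriform_CCAA x y p q).1 (E _ _ _ _).
  have caac p q := (invariant_dendriform_CAAC x y p q).1 (E _ _ _ _).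
  have acca p q := (invariant_dendriform_ACCA x y p q).1 (E _ _ _ _).
  have acac p q := (invariant_dendriform_ACAC x y p q).1 (E _ _ _ _).
  have caca p q := (invariant_dendriform_CACA x y p q).1 (E _ _ _ _).
  split; split=> p q.
  - by case: (caac p q).
  - by case: (aacc p q).
  - by case: (aacc p q).
  - by case: (caac p q).
  - by case: (aacc p q).
  - by case: (caac p q).
  - by case: (ccaa p q).
  - by case: (ccaa p q).
  - by case: (acca p q).
  - by case: (acca p q).
  - by case: (acac p q).
  - by case: (acac p q).
  - by case: (acac p q).
  - by case: (caca p q).
  - by case: (caca p q).
  - by case: (acca p q).
  - by case: (ccaa p q).
  - by case: (caca p q).
move=> E; apply/(dendriform_invariantP iQ B_inj).
have subl := invariant_dendriform_sub iQ qQ inl_morph cquadri_homl.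
have subr := invariant_dendriform_sub iQ qS inr_morph cquadri_homr.
move=> [x p] [y q] [z r] [w s]; rewrite (pair_decomp x p) (pair_decomp y q).
rewrite (pair_decomp z r) (pair_decomp w s).
(* Of the sixteen cases, ten have three arguments in one subalgebra; the other six are the patterns
   above. *)
apply: invariant_dendriformD1; apply: invariant_dendriformD2;
  apply: invariant_dendriformD3; apply: invariant_dendriformD4.
- by case: (subl x y z (w, 0)).
- by case: (subl x y z (0, s)).
- by case: (subl w x y (0, r)).
- by apply/invariant_dendriform_AACC; case: (E x y) =>
    -[e1 e2 e3 e4 e5] [e6 e7 e8 e9 e10] [e11 e12 e13 e14 e15] [e16 e17 e18];
    split; [exact: e3 | exact: e5 | exact: e2].
- by case: (subl z w x (0, q)).
- by apply/invariant_dendriform_ACAC; case: (E x z) =>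
    -[e1 e2 e3 e4 e5] [e6 e7 e8 e9 e10] [e11 e12 e13 e14 e15] [e16 e17 e18];
    split; [exact: e13 | exact: e11 | exact: e12].
- by apply/invariant_dendriform_ACCA; case: (E w x) =>
    -[e1 e2 e3 e4 e5] [e6 e7 e8 e9 e10] [e11 e12 e13 e14 e15] [e16 e17 e18];
    split; [exact: e16 | exact: e9 | exact: e10].
- by case: (subr q r s (x, 0)).
- by case: (subl y z w (0, p)).
- by apply/invariant_dendriform_CAAC; case: (E y z) =>
    -[e1 e2 e3 e4 e5] [e6 e7 e8 e9 e10] [e11 e12 e13 e14 e15] [e16 e17 e18];
    split; [exact: e1 | exact: e4 | exact: e6].
- by apply/invariant_dendriform_CACA; case: (E y w) =>
    -[e1 e2 e3 e4 e5] [e6 e7 e8 e9 e10] [e11 e12 e13 e14 e15] [e16 e17 e18];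
    split; [exact: e14 | exact: e18 | exact: e15].
- by case: (subr r s p (y, 0)).
- by apply/invariant_dendriform_CCAA; case: (E z w) =>
    -[e1 e2 e3 e4 e5] [e6 e7 e8 e9 e10] [e11 e12 e13 e14 e15] [e16 e17 e18];
    split; [exact: e7 | exact: e8 | exact: e17].
- by case: (subr s p q (z, 0)).
- by case: (subr p q r (w, 0)).
- by case: (subr p q r (0, s)).
Qed.

Lemma cquadri_unique (T : quadriOps (A * C)%type) :
  invariant_form T B -> quadri_hom Q T inl -> quadri_hom S T inr -> T = cquadri.
Proof.
move=> iT hl hr.
apply: (invariant_extension_unique B_inj _ Q S _ _ inl_morph inr_morph iT
  cquadri_invariant hl hr cquadri_homl cquadri_homr) => -[x a].
by exists x, a; exact: pair_decomp.
Qed.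

(** The cocycle splits [T] into invariant arrows. By the splitting conditions these extend [Q] and
    [S], and uniqueness identifies them with [cquadri]. *)
Lemma dendri_triple_cquadri :
  (exists T : dendriOps (A * C)%type,
    [/\ [/\ is_dendriform T, dendri_hom (vert Q) T inl, dendri_hom (vert S) T inr
          & two_cocycle T B],
        splits_by B T Q inl & splits_by B T S inr])
  <-> is_dendriform (vert cquadri).
Proof.
have iQ := cquadri_invariant.
split=> [[T [[dT _ _ cT] sl sr]] | dQ].
  have [T' iT' eT] := cocycle_splitting B_inj cT.
  rewrite -eT in dT sl sr.
  by rewrite -(cquadri_unique T') //; apply/(splits_byP B_inj iT').
exists (vert cquadri); split; [split | |] => //.
- exact: (quadri_hom_vert inl_morph cquadri_homl).
- exact: (quadri_hom_vert inr_morph cquadri_homr).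
- exact: invariant_cocycle.
- by apply/(splits_byP B_inj iQ)/cquadri_homl.
- by apply/(splits_byP B_inj iQ)/cquadri_homr.
Qed.

Lemma quadri_cquadri : is_quadri cquadri <-> is_dendriform (vert cquadri).
Proof.
by split=> [/quadri_vert // | ]; apply/dendriform_quadri/B_inj/cquadri_invariant.
Qed.

Lemma quadri_triple_cquadri :
  (exists T : quadriOps (A * C)%type,
    [/\ is_quadri T, quadri_hom Q T inl, quadri_hom S T inr & invariant_form T B])
  <-> is_dendriform (vert cquadri).
Proof.
split=> [[T [qT hl hr iT]] | /quadri_cquadri qQ].
  by rewrite -(cquadri_unique T) //; exact: quadri_vert.
exists cquadri; split => //; [exact: cquadri_homl | exact: cquadri_homr |].
exact: cquadri_invariant.
Qed.

Lemma vert_cquadri : vert cquadri = dendri_bowtie (vert Q) (vert S)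
  (DendriActs (- TR (qsw Q)) (TL (qsucc Q)) (TR (qprec Q)) (- TL (qne Q)))
  (DendriActs (- SR (qsw S)) (SL (qsucc S)) (SR (qprec S)) (- SL (qne S))).
Proof.
by rewrite /vert cquadri_wedge cquadri_vee /cbowtie !(TRN, TLN, SRN, SLN).
Qed.

Lemma cquadri_bowtie : cquadri = quadri_bowtie Q S
  (QuadriActs (TR (qse Q)) (TL (qstar Q)) (- TR (qvee Q)) (- TL (qprec Q))
              (- TR (qsucc Q)) (- TL (qwedge Q)) (TR (qstar Q)) (TL (qnw Q)))
  (QuadriActs (SR (qse S)) (SL (qstar S)) (- SR (qvee S)) (- SL (qprec S))
              (- SR (qsucc S)) (- SL (qwedge S)) (SR (qstar S)) (SL (qnw S))).
Proof. by rewrite /cquadri /cbowtie !(TRN, TLN, SRN, SLN). Qed.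

Lemma bowtie_equivalences : is_quadri Q -> is_quadri S ->
  let D := is_dendriform (dendri_bowtie (vert Q) (vert S)
    (DendriActs (- TR (qsw Q)) (TL (qsucc Q)) (TR (qprec Q)) (- TL (qne Q)))
    (DendriActs (- SR (qsw S)) (SL (qsucc S)) (SR (qprec S)) (- SL (qne S)))) in
  [/\ (exists T : dendriOps (A * C)%type,
        [/\ [/\ is_dendriform T, dendri_hom (vert Q) T inl,
                dendri_hom (vert S) T inr & two_cocycle T B],
            splits_by B T Q inl & splits_by B T S inr]) <-> D,
      (exists T : quadriOps (A * C)%type,
        [/\ is_quadri T, quadri_hom Q T inl, quadri_hom S T inr
          & invariant_form T B]) <-> D,
      is_quadri (quadri_bowtie Q S
        (QuadriActs (TR (qse Q)) (TL (qstar Q)) (- TR (qvee Q)) (- TL (qprec Q))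
          (- TR (qsucc Q)) (- TL (qwedge Q)) (TR (qstar Q)) (TL (qnw Q)))
        (QuadriActs (SR (qse S)) (SL (qstar S)) (- SR (qvee S)) (- SL (qprec S))
          (- SR (qsucc S)) (- SL (qwedge S)) (SR (qstar S)) (SL (qnw S)))) <-> D
    & D <-> quadri_compatible].
Proof.
move=> qQ qS; rewrite /= -vert_cquadri -cquadri_bowtie.
split.
- exact: dendri_triple_cquadri.
- exact: quadri_triple_cquadri.
- exact: quadri_cquadri.
- exact: invariant_dendriform_cquadri.
Qed.

End CyclicQuadri.

End CyclicBowtie.

(** All conditions are compared with the one statement [D], that the vertical bowtie is
    dendriform. *)
Lemma matched_tfae {P1 P2 D M C P5 dA dB qA qB : Prop} :
  P1 <-> D -> P2 <-> D -> M <-> D -> D <-> C -> C <-> P5 ->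
  dA -> dB -> qA -> qB ->
  [<-> P1; P2; [/\ dA, dB & D]; [/\ qA, qB & M]; P5].
Proof.
move=> h1 h2 h4 h5 h6 hdA hdB hqA hqB; tfae.
- by move/h1/h2.
- by move/h2.
- by case=> _ _ /h4.
- by case=> _ _ /h4 /h5 /h6.
- by move/h6/h5/h1.
Qed.

(** * Comultiplications as products on the dual *)

Section Codual.
Context {F : fieldType} {A : vectType F}.
Implicit Types (D : 'Hom(A, tensor A A)) (T : tensor A A) (r : act A A).

Lemma codualD D1 D2 : codual (D1 + D2) = codual D1 + codual D2.
Proof.
apply: hom_ext2 => p q; apply: dualP => x.
by rewrite codualE !add_lfunE !codualE.
Qed.

Lemma tmap_idr r y T (p q : dual A) :
  tmap (r y) \1%VF T p q = T (dualrep r y p) q.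
Proof.
rewrite tmapE; congr (T _ _); apply: dualP => x; rewrite comp_lfunE.
  by rewrite dualrepE.
by rewrite id_lfunE.
Qed.

Lemma tmap_idl r y T (p q : dual A) :
  tmap \1%VF (r y) T p q = T p (dualrep r y q).
Proof.
rewrite tmapE; congr (T _ _); apply: dualP => x; rewrite comp_lfunE.
  by rewrite id_lfunE.
by rewrite dualrepE.
Qed.

Lemma flipD T1 T2 : flip (T1 + T2) = flip T1 + flip T2.
Proof. by apply: tensorP => p q; rewrite tensorD !flipE tensorD. Qed.

Lemma tensorP_iff T1 T2 : T1 = T2 <-> forall p q, T1 p q = T2 p q.
Proof. by split=> [-> // | ]; exact: tensorP. Qed.

Lemma tensorB T1 T2 p q : (T1 - T2) p q = T1 p q - T2 p q.
Proof. by rewrite tensorD tensorN. Qed.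

(** The vector comes first, to match the abstract pairing [e]. *)
Definition evpair (x : A) (p : dual A) : F := p x.

Section Shapes.
Context (D D1 D2 D3 : 'Hom(A, tensor A A)) (r1 r2 r3 r4 : act A A).

(** The bialgebra conditions have seven shapes, each evaluated here on [p], [q]. The suffix [rl]
    means that the term acting on the first tensor factor is written first, [lr] the opposite. *)
Lemma cobracket_rl z x x1 y y1 :
  D z = tmap (r1 x1) \1%VF (D1 x) + tmap \1%VF (r2 y1) (D2 y) <->
  forall p q,
    evpair z (codual D p q) = evpair x (codual D1 (dualrep r1 x1 p) q) +
      evpair y (codual D2 p (dualrep r2 y1 q)).
Proof.
apply: (iff_trans (tensorP_iff _ _)).
by split=> e p q; move: (e p q);
  rewrite /evpair !(tensorB, tensorD, tmap_idl, tmap_idr, flipE, codualE).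
Qed.

Lemma cobracket_lr z x x1 y y1 :
  D z = tmap \1%VF (r2 y1) (D2 y) + tmap (r1 x1) \1%VF (D1 x) <->
  forall p q,
    evpair z (codual D p q) = evpair y (codual D2 p (dualrep r2 y1 q)) +
      evpair x (codual D1 (dualrep r1 x1 p) q).
Proof.
apply: (iff_trans (tensorP_iff _ _)).
by split=> e p q; move: (e p q);
  rewrite /evpair !(tensorB, tensorD, tmap_idl, tmap_idr, flipE, codualE).
Qed.

Lemma twisted_single x y :
  tmap \1%VF (r1 y) (flip (D x)) - tmap (r2 y) \1%VF (flip (D x)) =
    tmap \1%VF (r3 x) (D1 y) - tmap (r4 x) \1%VF (D1 y) <->
  forall p q,
    evpair x (codual D (dualrep r1 y q) p) -
      evpair x (codual D q (dualrep r2 y p)) =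
    evpair y (codual D1 p (dualrep r3 x q))
      - evpair y (codual D1 (dualrep r4 x p) q).
Proof.
apply: (iff_trans (tensorP_iff _ _)).
by split=> e p q; move: (e p q);
  rewrite /evpair !(tensorB, tensorD, tmap_idl, tmap_idr, flipE, codualE).
Qed.

Lemma twisted_mixed x y :
  tmap \1%VF (r1 x) (D y) - tmap (r2 x) \1%VF (D y) =
    tmap \1%VF (r3 y) (flip (D1 x)) - tmap (r4 y) \1%VF (flip (D2 x)) <->
  forall p q,
    evpair y (codual D p (dualrep r1 x q)) -
      evpair y (codual D (dualrep r2 x p) q) =
    evpair x (codual D1 (dualrep r3 y q) p)
      - evpair x (codual D2 q (dualrep r4 y p)).
Proof.
apply: (iff_trans (tensorP_iff _ _)).
by split=> e p q; move: (e p q);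
  rewrite /evpair !(tensorB, tensorD, tmap_idl, tmap_idr, flipE, codualE).
Qed.

Lemma twisted_rl x y :
  tmap (r1 y) \1%VF (flip (D x) + flip (D1 x))
    - tmap \1%VF (r2 y) (flip (D x) + flip (D1 x)) =
    tmap (r3 x) \1%VF (D2 y) - tmap \1%VF (r4 x) (D3 y) <->
  forall p q,
    evpair x (codual (D + D1) q (dualrep r1 y p)) -
      evpair x (codual (D + D1) (dualrep r2 y q) p) =
    evpair y (codual D2 (dualrep r3 x p) q)
      - evpair y (codual D3 p (dualrep r4 x q)).
Proof.
(* The two flips are merged, so that the product dual to [D + D1] appears. *)
apply: (iff_trans (tensorP_iff _ _)); rewrite -flipD -add_lfunE.
by split=> e p q; move: (e p q);
  rewrite /evpair !(tensorB, tensorD, tmap_idl, tmap_idr, flipE, codualE).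
Qed.

Lemma twisted_lr x y :
  tmap \1%VF (r1 x) (flip (D y) + flip (D1 y))
    - tmap (r2 x) \1%VF (flip (D y) + flip (D1 y)) =
    tmap \1%VF (r3 y) (D2 x) - tmap (r4 y) \1%VF (D3 x) <->
  forall p q,
    evpair y (codual (D + D1) (dualrep r1 x q) p) -
      evpair y (codual (D + D1) q (dualrep r2 x p)) =
    evpair x (codual D2 p (dualrep r3 y q))
      - evpair x (codual D3 (dualrep r4 y p) q).
Proof.
apply: (iff_trans (tensorP_iff _ _)); rewrite -flipD -add_lfunE.
by split=> e p q; move: (e p q);
  rewrite /evpair !(tensorB, tensorD, tmap_idl, tmap_idr, flipE, codualE).
Qed.
End Shapes.

Lemma twisted_sum (D D1 D2 D3 D4 D5 : 'Hom(A, tensor A A)) r1 r2 r3 r4 x y :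
  tmap (r1 y) \1%VF (D x) + tmap \1%VF (r2 x) (flip (D1 y) + flip (D2 y)) =
    tmap (r3 x) \1%VF (flip (D3 y) + flip (D4 y)) + tmap \1%VF (r4 y) (D5 x) <->
  forall p q,
    evpair x (codual D (dualrep r1 y p) q) +
      evpair y (codual (D1 + D2) (dualrep r2 x q) p) =
    evpair y (codual (D3 + D4) q (dualrep r3 x p))
      + evpair x (codual D5 p (dualrep r4 y q)).
Proof.
apply: (iff_trans (tensorP_iff _ _)); rewrite -!flipD -!add_lfunE.
by split=> e p q; move: (e p q);
  rewrite /evpair !(tensorB, tensorD, tmap_idl, tmap_idr, flipE, codualE).
Qed.

Lemma evpairDl (x y : A) (p : dual A) :
  evpair (x + y) p = evpair x p + evpair y p.
Proof. exact (hom_appD p x y). Qed.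
Lemma evpairDr (x : A) (p q : dual A) :
  evpair x (p + q) = evpair x p + evpair x q.
Proof. exact: dualD. Qed.
Lemma evpair_dualrep_Rop (o : bilop A) x p y :
  evpair y (dualrep (Rop o) x p) = evpair (o y x) p.
Proof. by rewrite /evpair dualrepE RopE. Qed.
Lemma evpair_dualrep_Lop (o : bilop A) x p y :
  evpair y (dualrep (Lop o) x p) = evpair (o x y) p.
Proof. exact: dualrepE. Qed.
Lemma evpair_predualrep_Rop (s : bilop (dual A)) p x q :
  evpair (predualrep (Rop s) p x) q = evpair x (s q p).
Proof. by rewrite /evpair predualrepE RopE. Qed.
Lemma evpair_predualrep_Lop (s : bilop (dual A)) p x q :
  evpair (predualrep (Lop s) p x) q = evpair x (s p q).
Proof. exact: predualrepE. Qed.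

Lemma dual_bowtie_equivalences (Q : quadriOps A) (S : quadriOps (dual A)) :
  is_quadri Q -> is_quadri S ->
  let Rt (op : bilop A) := dualrep (Rop op) in
  let Lt (op : bilop A) := dualrep (Lop op) in
  let Rs (op : bilop (dual A)) := predualrep (Rop op) in
  let Ls (op : bilop (dual A)) := predualrep (Lop op) in
  let D := is_dendriform (dendri_bowtie (vert Q) (vert S)
    (DendriActs (- Rt (qsw Q)) (Lt (qsucc Q)) (Rt (qprec Q)) (- Lt (qne Q)))
    (DendriActs (- Rs (qsw S)) (Ls (qsucc S)) (Rs (qprec S)) (- Ls (qne S)))) in
  [/\ (exists T : dendriOps (dsum A),
        [/\ dendri_manin_triple (vert Q) (vert S) T,
            splits_by (BS A) T Q (@inA F A)
          & splits_by (BS A) T S (@inD F A)]) <-> D,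
      (exists T : quadriOps (dsum A), quadri_manin_triple Q S T) <-> D,
      is_quadri (quadri_bowtie Q S
        (QuadriActs (Rt (qse Q)) (Lt (qstar Q)) (- Rt (qvee Q)) (- Lt (qprec Q))
          (- Rt (qsucc Q)) (- Lt (qwedge Q)) (Rt (qstar Q)) (Lt (qnw Q)))
        (QuadriActs (Rs (qse S)) (Ls (qstar S)) (- Rs (qvee S)) (- Ls (qprec S))
          (- Rs (qsucc S)) (- Ls (qwedge S)) (Rs (qstar S)) (Ls (qnw S)))) <-> D
    & D <-> quadri_compatible evpair Rt Lt Q S].
Proof.
exact (@bowtie_equivalences F A (dual A) (fun x p => evpair x p)
  (* The transposes left implicit are inferred from the four evaluation lemmas passed next. *)
  evpairDl evpairDr (@dual_sep _ A) (@dualP _ A) _ _ _ _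
  evpair_dualrep_Rop evpair_dualrep_Lop evpair_predualrep_Rop evpair_predualrep_Lop
  (BS A) (fun x a y b => BSE x y a b) Q S).
Qed.

(** * The eighteen bialgebra conditions *)

Section Bialgebra.
Context (Q : quadriOps A) (al be tal tbe : 'Hom(A, tensor A A)).
Let S := codual_ops al be tal tbe.
Local Notation TR := (fun o : bilop A => dualrep (Rop o)).
Local Notation TL := (fun o : bilop A => dualrep (Lop o)).

Lemma bialgebra_compatible : is_quadri Q -> is_quadri S ->
  quadri_compatible evpair TR TL Q S <-> is_quadri_bialgebra Q al be tal tbe.
Proof.
move=> qQ qS.
have sE : qsucc S = codual (be + tbe) by rewrite codualD.
have pE : qprec S = codual (al + tal) by rewrite codualD.
have vE : qvee S = codual (tal + tbe) by rewrite codualD.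
have wE : qwedge S = codual (al + be) by rewrite codualD.
have tE : qstar S = codual (al + be + tal + tbe) by rewrite !codualD.
(* The total comultiplication is written in two different orders among the conditions. *)
have aE : al + tal + be + tbe = al + be + tal + tbe by rewrite (addrAC al).
rewrite /quadri_compatible sE pE vE wE tE /= /is_quadri_bialgebra.
split=> [E | [_ _ E] x y]; last first.
  case: (E x y) => [].
  rewrite aE.
  move=> [/cobracket_rl e1 /cobracket_rl e2 /cobracket_rl e3 /cobracket_rl e4
      /cobracket_lr e5].
  move=> [/cobracket_lr e6 /cobracket_lr e7 /cobracket_lr e8 /cobracket_rl e9
      /cobracket_rl e10].
  move=> [/twisted_single e11 /twisted_mixed e12 /twisted_rl e13 /twisted_lr e14
      /twisted_lr e15].
  move=> [/cobracket_rl e16 /cobracket_rl e17 /twisted_sum e18].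
  by split; split.
split=> [||x y]; [exact: qQ | exact: qS |]; rewrite aE.
case: (E x y) => -[e1 e2 e3 e4 e5] [e6 e7 e8 e9 e10] [e11 e12 e13 e14 e15]
  [e16 e17 e18].
split; split.
- by apply/cobracket_rl => p q; rewrite (e1 p q).
- by apply/cobracket_rl => p q; rewrite (e2 p q).
- by apply/cobracket_rl => p q; rewrite (e3 p q).
- by apply/cobracket_rl => p q; rewrite (e4 p q).
- by apply/cobracket_lr; exact e5.
- by apply/cobracket_lr => p q; rewrite (e6 p q).
- by apply/cobracket_lr => p q; rewrite (e7 p q).
- by apply/cobracket_lr => p q; rewrite (e8 p q).
- by apply/cobracket_rl => p q; rewrite (e9 p q).
- by apply/cobracket_rl; exact e10.
- by apply/twisted_single => p q; rewrite (e11 p q).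
- by apply/twisted_mixed => p q; rewrite (e12 p q).
- by apply/twisted_rl => p q; rewrite (e13 p q).
- by apply/twisted_lr => p q; rewrite (e14 p q).
- by apply/twisted_lr => p q; rewrite (e15 p q).
- by apply/cobracket_rl => p q; rewrite (e16 p q).
- by apply/cobracket_rl => p q; rewrite (e17 p q).
- by apply/twisted_sum => p q; rewrite (e18 p q).
Qed.
End Bialgebra.
End Codual.

Theorem theorem5p3 (F : fieldType) (A : vectType F) (Q : quadriOps A)
    (al be tal tbe : 'Hom(A, tensor A A))
    (hQ : is_quadri Q) (hC : is_quadri_coalgebra al be tal tbe) :
  let Qs := codual_ops al be tal tbe in
  let Rt (op : bilop A) := dualrep (Rop op) in
  let Lt (op : bilop A) := dualrep (Lop op) in
  let Rs (op : bilop (dual A)) := predualrep (Rop op) in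
  let Ls (op : bilop (dual A)) := predualrep (Lop op) in
  [<->
    (exists D : dendriOps (dsum A),
       [/\ dendri_manin_triple (vert Q) (vert Qs) D,
           splits_by (BS A) D Q (@inA F A)
         & splits_by (BS A) D Qs (@inD F A)]);
    (exists QQ : quadriOps (dsum A), quadri_manin_triple Q Qs QQ);
    dendri_matched_pair (vert Q) (vert Qs)
      (DendriActs (- Rt (qsw Q)) (Lt (qsucc Q)) (Rt (qprec Q)) (- Lt (qne Q)))
      (DendriActs (- Rs (qsw Qs)) (Ls (qsucc Qs))
                  (Rs (qprec Qs)) (- Ls (qne Qs)));
    quadri_matched_pair Q Qs
      (QuadriActs (Rt (qse Q)) (Lt (qstar Q)) (- Rt (qvee Q)) (- Lt (qprec Q))
                  (- Rt (qsucc Q)) (- Lt (qwedge Q)) (Rt (qstar Q)) (Lt (qnw Q)))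
      (QuadriActs (Rs (qse Qs)) (Ls (qstar Qs)) (- Rs (qvee Qs)) (- Ls (qprec Qs))
                  (- Rs (qsucc Qs)) (- Ls (qwedge Qs))
                  (Rs (qstar Qs)) (Ls (qnw Qs)));
    is_quadri_bialgebra Q al be tal tbe].
Proof.
move=> Qs Rt Lt Rs Ls.
destruct (dual_bowtie_equivalences Q Qs hQ hC) as [h1 h2 h4 h5].
exact (matched_tfae h1 h2 h4 h5 (bialgebra_compatible Q al be tal tbe hQ hC)
  (quadri_vert Q hQ) (quadri_vert Qs hC) hQ hC).
Qed.
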